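(* For every real $c> 1$, there is a positive integer $\ell$ and a constant $C(c)\ge 1$ such that for every sufficiently large prime $p$ (large enough in terms of $c$) there is a constant $D(c,p)\ge 1$ such that the following holds for all positive integers $n$. If $A\subseteq \mathbb{F}_p^n$ is a subset of size $|A|\ge D(c,p)\cdot (C(c))^n$ with $|\ell A|\le |A|^c$, then $A$ contains $p$ distinct vectors $x_1,\dots,x_p\in A$ with $x_1+\dots+x_p=0$.
   Context: For a subset $A\subseteq\mathbb{F}_p^n$ and a positive integer $\ell$, $\ell A=\{x_1+\dots+x_\ell\mid x_1,\dots,x_\ell\in A\}$ denotes the $\ell$-fold sumset. *)

(* Defs.v *)
From mathcomp Require Import all_boot all_order all_algebra.
Set Implicit Arguments.
Unset Strict Implicit.
Unset Printing Implicit Defensive.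
Import GRing.Theory.
Local Open Scope ring_scope.

(* The summands are not required to be distinct. *)
Definition sumset (V : finZmodType) (l : nat) (A : {set V}) : {set V} :=
  [set \sum_(i < l) x i | x : {ffun 'I_l -> V} in ffun_on A].

(* Main.v *)
Require Import Defs.
From mathcomp Require Import all_boot all_order all_algebra.
From mathcomp Require Import reals exp.
From mathcomp Require Import finfield zify ring lra.
Import Order.TTheory GRing.Theory Num.Theory.
Local Open Scope ring_scope.

(** Induction on [d], where [|lA|^2 <= |A|^d]; the case [d = 1] is void. Suppose that [A] has no
    [p] distinct elements with sum zero. Take [s] maximal such that a positive proportion of [A]
    is covered by disjoint zero-sum [p]-tuples with at least [s] distinct entries; after deleting
    few elements, no zero-sum [p]-tuple has more than [s < p] distinct entries. The slice rank
    bound for [p] colours, applied after appending random coordinates, recombines any [C^n] of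
    these tuples into a new one whose entries come from more than [K] of them. Since [s] is
    maximal, an entry [b] that is repeated in it cannot be exchanged: by the sunflower lemma, [b]
    is determined, up to boundedly many choices, by the sum of [b] and [K] other entries. So a
    dense family of [K]-tuples of [A] has at most about [|lA| / |A|] sums. Dependent random choice
    (a Balog-Szemeredi-Gowers argument for many summands) and Plunnecke's inequality turn this
    into a large subset [A'] of [A] with [|l'A'|^2 <= |A'|^(d-1)]. *)

Set Implicit Arguments. Unset Strict Implicit. Unset Printing Implicit Defensive.

(** * The slice rank bound *)

(** The base [C] must not depend on [p]. Each term of the polynomial behind the slice rank bound has
    degree at most [N] in one of the [p] colours, and [N] variables admit at most [4 ^ N] such
    monomials, whatever [p] is. Slice rank alone gives a recombination that is merely nonconstant;
    it might mix only two tuples, which says nothing about sums of many elements. The [n'] extra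
    coordinates must beat the roughly [N ^ K] recombinations of few tuples, while [N] itself has to
    exceed [4 ^ (n + n')]; taking [p >= 64 ^ K] reconciles the two demands, and this is the use of a
    large prime. A repeated entry matters because exchanging it at one position leaves its old value
    present at another, so that an exchange would raise the number of distinct entries. Passing to
    sums of [K] entries lowers the growth exponent by a full 1; half of this pays for the losses on
    the way to [A'], which is why the exponent moves in steps of 1/2. *)

Lemma exists_orthogonal (F : fieldType) (J E : finType) (S : {set J})
    (psi : E -> J -> F) :
  (#|E| < #|S|)%N ->
  exists h : J -> F, [/\ forall j, j \notin S -> h j = 0,
    exists j, h j != 0 & forall e, \sum_j h j * psi e j = 0].
Proof.
move=> ltES.
pose M := \matrix_(i < #|S|, e < #|E|) psi (enum_val e) (enum_val i).
have kn0 : kermx M != 0.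
  rewrite kermx_eq0 /row_free; apply: contraTneq ltES => rkM.
  by rewrite -leqNgt -rkM rank_leq_col.
have /rowV0Pn[v /sub_kermxP vM vn0] := kn0.
pose h j := \sum_(i < #|S| | enum_val i == j) v 0 i.
have hE i : h (enum_val i) = v 0 i.
  rewrite /h (bigD1 i) //= big1 ?addr0 // => k /andP[/eqP /enum_val_inj ->].
  by rewrite eqxx.
exists h; split.
- move=> j jS; rewrite /h big1 // => i /eqP ij.
  by move: jS; rewrite -ij enum_valP.
- have /rV0Pn[i vi] := vn0.
  by exists (enum_val i); rewrite hE.
- move=> e; rewrite -[RHS](_ : (v *m M) 0 (enum_rank e) = 0); last first.
    by rewrite vM mxE.
  rewrite mxE /h.
  under eq_bigr do rewrite big_distrl /=.
  rewrite (exchange_big_dep predT) //=; apply: eq_bigr => i _.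
  rewrite (big_pred1 (enum_val i)) => [|j]; last by rewrite /= eq_sym.
  by rewrite mxE enum_rankK.
Qed.

(** The support grows greedily: while more than [#|E|] points of [S] lie outside it, an orthogonal
    vector supported on those points can be added, and disjoint supports exclude cancellation. *)
Lemma exists_orthogonal_large_support (F : fieldType) (J E : finType) (S : {set J})
    (psi : E -> J -> F) :
  exists h : J -> F, [/\ forall j, j \notin S -> h j = 0,
    (#|S| <= #|[set j | h j != 0%R]| + #|E|)%N & forall e, \sum_j h j * psi e j = 0].
Proof.
pose good n := exists h : J -> F, [/\ forall j, j \notin S -> h j = 0,
  forall e, \sum_j h j * psi e j = 0 & (n <= #|[set j | h j != 0%R]|)%N].
suff: forall n, (n + #|E| <= #|S|)%N -> good n.
  case: (leqP #|E| #|S|) => [le_ES|lt_SE].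
    move=> /(_ (#|S| - #|E|)%N); rewrite subnK // => /(_ (leqnn _)).
    by case=> h [h0 h1 h2]; exists h; split=> //; lia.
  move=> _; exists (fun=> 0); split=> //; first lia.
  by move=> e; rewrite big1 // => j _; rewrite mul0r.
elim=> [|n IHn] le_n.
  exists (fun=> 0); split=> //.
  by move=> e; rewrite big1 // => j _; rewrite mul0r.
have [|h [h0 h1 h2]] := IHn; first lia.
have [lt_n|ge_n] := ltnP n #|[set j | h j != 0%R]|; first by exists h.
have sub_S : [set j | h j != 0] \subset S.
  by apply/subsetP=> j; rewrite inE; apply: contraNT => /h0 ->.
have [|k [k0 [j kj] k1]] := @exists_orthogonal F J E (S :\: [set j | h j != 0]) psi.
  by rewrite cardsD (setIidPr sub_S); lia.
exists (fun j => h j + k j); split.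
- by move=> i iS; rewrite h0 ?k0 ?addr0 // inE (negPf iS) andbF.
- move=> e; under eq_bigr do rewrite mulrDl.
  by rewrite big_split /= h1 k1 addr0.
have hk0 i : h i != 0 -> k i = 0 by move=> hi; rewrite k0 // !inE hi.
have hj : h j = 0 by apply/eqP; apply: contraNT kj => /hk0 ->.
have /subset_leq_card : j |: [set i | h i != 0] \subset [set i | h i + k i != 0].
  apply/subsetP=> i; rewrite !inE => /orP[/eqP ->|hi]; first by rewrite hj add0r.
  by rewrite hk0 ?addr0.
rewrite cardsU1 inE hj eqxx /=; apply: leq_trans; rewrite add1n ltnS; exact: h2.
Qed.

Section SliceRank.
Variables (F : fieldType) (J E K : finType) (d : nat).
Variables (phi : K -> 'I_d.+2 -> J -> F) (psi : 'I_d.+2 -> E -> J -> F).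
Variables (sel : K -> 'I_d.+2) (ex : K -> E).
Hypothesis phi_sel : forall k, phi k (sel k) =1 psi (sel k) (ex k).

Let T (g : {ffun 'I_d.+2 -> J}) := \sum_k \prod_j phi k j (g j).

Hypothesis T0 : forall g, T g != 0 -> forall i j, g i = g j.
Hypothesis T1 : forall x, T [ffun=> x] != 0.

Let contraction (h : 'I_d.+2 -> J -> F) :
  \sum_x (\prod_j h j x) * T [ffun=> x] = \sum_k \prod_j \sum_x h j x * phi k j x.
Proof.
transitivity (\sum_(g : {ffun 'I_d.+2 -> J}) (\prod_j h j (g j)) * T g).
  rewrite (bigID (fun g : {ffun 'I_d.+2 -> J} => g == [ffun=> g ord0])) /=.
  rewrite [X in _ = _ + X]big1 ?addr0; last first.
    move=> g gN; apply/eqP; rewrite mulf_eq0; apply/orP; right.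
    apply: contraNT gN => /T0 gc; apply/eqP/ffunP=> i; rewrite ffunE; exact: gc.
  rewrite (reindex (fun x : J => [ffun=> x] : {ffun 'I_d.+2 -> J})) /=; last first.
    exists (fun g : {ffun 'I_d.+2 -> J} => g ord0) => [x _|g]; first by rewrite ffunE.
    by rewrite inE => /eqP <-.
  apply: eq_big => [x|x _]; first by rewrite ffunE eqxx.
  by congr (_ * _); apply: eq_bigr => j _; rewrite ffunE.
rewrite /T; under eq_bigr do rewrite big_distrr /=.
rewrite exchange_big /=; apply: eq_bigr => k _.
rewrite bigA_distr_bigA; apply: eq_bigr => g _.
by rewrite big_split.
Qed.

(** Tao's argument: contracting the first [d] colours with vectors orthogonal to their slices leaves
    a diagonal matrix with at least [#|J| - d * #|E|] nonzero entries, written with [2 * #|E|]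
    slices. Terms are counted only through the pairs ([sel k], [ex k]), so [K] may be exponentially
    large. *)
Lemma slice_rank_bound : (#|J| <= d.+2 * #|E|)%N.
Proof.
have [h [S [hS hort hsz]]] : exists (h : 'I_d.+2 -> J -> F) (S : {set J}),
   [/\ forall (j : 'I_d.+2) x, (j < d)%N -> x \in S -> h j x != 0,
       forall (j : 'I_d.+2) e, (j < d)%N -> \sum_x h j x * psi j e x = 0 &
       (#|J| <= #|S| + d * #|E|)%N].
  suff: forall t, (t <= d)%N -> exists (h : 'I_d.+2 -> J -> F) (S : {set J}),
   [/\ forall (j : 'I_d.+2) x, (j < t)%N -> x \in S -> h j x != 0,
       forall (j : 'I_d.+2) e, (j < t)%N -> \sum_x h j x * psi j e x = 0 &
       (#|J| <= #|S| + t * #|E|)%N] by exact.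
  elim=> [|t IHt] le_td.
    by exists (fun _ _ => 0), [set: J]; split=> //; rewrite cardsT addn0.
  have [|h [S [hS hort hsz]]] := IHt; first lia.
  have lt_t : (t < d.+2)%N by lia.
  have [k [k0 ksz kort]] := exists_orthogonal_large_support S (psi (Ordinal lt_t)).
  (* The new [S] is the support of [k], which lies inside the old one, so the earlier vectors stay
     nonzero on it. *)
  exists (fun j : 'I_d.+2 => if j == t :> nat then k else h j), [set x | k x != 0]; split.
  - move=> j x; rewrite ltnS leq_eqVlt inE => /orP[->//|jt] kx.
    rewrite ltn_eqF //; apply: hS => //; by apply: contraNT kx => /k0 ->.
  - move=> j e; rewrite ltnS leq_eqVlt; case: eqP => [jt _|_ /= jt]; last exact: hort.
    by rewrite (_ : j = Ordinal lt_t) //; apply: val_inj.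
  - by rewrite mulSn; lia.
rewrite leqNgt; apply/negP => lt_J.
have ltS : (#|{: E + E}| < #|S|)%N by rewrite card_sum; lia.
have lt_d : (d < d.+2)%N by lia.
have lt_d1 : (d.+1 < d.+2)%N by lia.
pose jd := Ordinal lt_d; pose jd1 := Ordinal lt_d1.
(* Besides the slices of colour [d], the new vector kills the coefficients of the
   slices of the last colour. *)
pose G e x := \sum_(k | (sel k == jd1) && (ex k == e))
  (\prod_(j : 'I_d.+2 | (j < d)%N) \sum_y h j y * phi k j y) * phi k jd x.
have [k [k0 [x kx] kort]] := @exists_orthogonal F J _ S
  (fun e => match e with inl e => psi jd e | inr e => G e end) ltS.
have xS : x \in S by apply: contraNT kx => /k0 ->.
(* With a point mass at [x] in the last colour, the diagonal side of [contraction] is the single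
   nonzero term at [x], while every slice on the other side is annihilated. *)
pose h' (j : 'I_d.+2) := if (j < d)%N then h j else if j == jd then k else fun y => (y == x)%:R.
have := contraction h'; rewrite (bigD1 x) //= [X in _ + X]big1 ?addr0; last first.
  move=> y yx; rewrite (bigD1 jd1) //= /h' /= ltnNge leqnSn /=.
  by rewrite (_ : jd1 == jd = false) ?(negPf yx) ?mul0r //; apply/negP => /eqP [] /esym/n_Sn.
have -> : \sum_k0 \prod_j \sum_y h' j y * phi k0 j y = 0.
  have split3 (f : 'I_d.+2 -> F) :
      \prod_j f j = (\prod_(j : 'I_d.+2 | (j < d)%N) f j) * f jd * f jd1.
    rewrite (bigD1 jd1) //= (bigD1 jd) /=; last by apply/eqP => -[]; lia.
    rewrite mulrC [f jd * _]mulrC; congr (_ * _ * _); apply: eq_bigl => j.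
    have := ltn_ord j; rewrite -!val_eqE /=; lia.
  have h'd : h' jd = k by rewrite /h' /= ltnn eqxx.
  have h'd1 : h' jd1 = fun y => (y == x)%:R.
    rewrite /h' /= ltnNge leqnSn /= (_ : jd1 == jd = false) //.
    by apply/negP => /eqP [] /esym/n_Sn.
  have h'lt (j : 'I_d.+2) : (j < d)%N -> h' j = h j by rewrite /h' => ->.
  rewrite (bigID (fun c => sel c == jd1)) /= [X in _ + X]big1 ?addr0; last first.
    move=> c cN; rewrite (bigD1 (sel c)) //=; apply/eqP; rewrite mulf_eq0; apply/orP; left.
    under eq_bigr do rewrite phi_sel.
    have [lt_c|ge_c] := ltnP (sel c) d; first by rewrite h'lt // hort.
    have -> : sel c = jd.
      by apply: val_inj; move: (ltn_ord (sel c)) cN; rewrite -val_eqE /=; lia.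
    by rewrite h'd (kort (inl (ex c))).
  rewrite (partition_big ex predT) //= big1 // => e _.
  transitivity ((\sum_y k y * G e y) * psi jd1 e x); last by rewrite (kort (inr e)) mul0r.
  rewrite /G; under [in RHS]eq_bigr do rewrite big_distrr /=.
  rewrite exchange_big /= big_distrl /=; apply: eq_bigr => c /andP[/eqP cs /eqP ce].
  rewrite split3 h'd h'd1.
  have -> : \sum_y (y == x)%:R * phi c jd1 y = psi jd1 e x.
    rewrite (bigD1 x) //= eqxx mul1r big1 ?addr0 => [|y /negPf ->]; last by rewrite mul0r.
    by rewrite -cs -ce phi_sel.
  congr (_ * _); rewrite big_distrr /=; apply: eq_bigr => y _.
  under eq_bigr => j jd_lt do rewrite h'lt //.
  by rewrite mulrCA.
move/eqP; rewrite mulf_eq0 (negPf (T1 x)) orbF prodf_seq_eq0 => /hasP[j _ /=].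
rewrite /h'; case: ltnP => [lt_j|_]; first by rewrite (negPf (hS j x lt_j xS)).
by case: ifP; rewrite ?(negPf kx) // eqxx oner_eq0.
Qed.
End SliceRank.

(** Rankin's trick: under the weight [\prod_i 2 ^ (N - e i)] each counted vector weighs at least
    [2 ^ (N * N - N)], and the total weight factors as [(2 ^ N.+1 - 1) ^ N]. *)
Lemma card_low_degree_exponents (N : nat) :
  (#|{: {e : {ffun 'I_N -> 'I_N.+1} | \sum_i e i <= N}}| <= 4 ^ N)%N.
Proof.
rewrite card_sig /=.
set P := (X in #|X|).
have : (#|P| * 2 ^ (N * N - N) <= \sum_(e : {ffun 'I_N -> 'I_N.+1}) \prod_i 2 ^ (N - e i))%N.
  rewrite -sum_nat_const big_mkcond /=; apply: leq_sum => e _.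
  case: ifP => // eP; rewrite -expn_sum leq_exp2l //.
  have : (\sum_(i < N) (N - e i) + \sum_(i < N) e i = N * N)%N.
    rewrite -big_split /= (eq_bigr (fun=> N)); last by move=> i _; have := ltn_ord (e i); lia.
    by rewrite sum_nat_const card_ord.
  by move: eP; rewrite /P unfold_in /=; lia.
rewrite -(bigA_distr_bigA (fun (i : 'I_N) (k : 'I_N.+1) => 2 ^ (N - k)))%N.
rewrite prod_nat_const card_ord.
have -> : (\sum_(k < N.+1) 2 ^ (N - k) = 2 ^ N.+1 - 1)%N.
  rewrite (reindex_inj rev_ord_inj) /=.
  rewrite (eq_bigr (fun i : 'I_N.+1 => 2 ^ i)%N); last first.
    by move=> i _; congr (2 ^ _)%N; have := ltn_ord i; lia.
  elim: N.+1 => [|n IHn]; first by rewrite big_ord0.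
  by rewrite big_ord_recr /= IHn expnS; have := expn_gt0 2 n; lia.
move=> le1; rewrite -(@leq_pmul2r (2 ^ (N * N - N))) ?expn_gt0 //.
apply: leq_trans le1 _.
apply: (@leq_trans ((2 ^ N.+1) ^ N)%N); first by case: (posnP N) => [->//|N0]; rewrite leq_exp2r ?leq_subr.
rewrite -[4%N]/(2 ^ 2)%N -!expnM -expnD leq_exp2l //.
by case: N {P} => // N; nia.
Qed.

Section MultiColoredSumFree.
Variables (d N : nat).
Local Notation p := d.+2.
Hypothesis p_prime : prime p.
Variables (J : finType) (x : 'I_p -> J -> 'rV['F_p]_N).

(** A term in the expansion of the product over coordinates of [1 - (sum of the colours) ^ (p - 1)]:
    at each coordinate either the 1, or one colour for each of the [p - 1] factors. *)
Local Notation K := {ffun 'I_N -> option {ffun 'I_d.+1 -> 'I_p}}.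
Local Notation E := {e : {ffun 'I_N -> 'I_N.+1} | (\sum_i e i <= N)%N}.

Let expo (k : K) (j : 'I_p) (v : 'I_N) : nat :=
  if k v is Some ka then #|[pred r | ka r == j]| else 0%N.

Let expo_sum (k : K) v : (\sum_j expo k j v <= d.+1)%N.
Proof.
rewrite /expo; case: (k v) => [ka|]; last by rewrite big1.
under eq_bigr do rewrite -sum1_card.
rewrite (eq_bigr (fun j => \sum_(r | ka r == j) 1)%N) //.
by rewrite -(@partition_big _ _ _ _ _ _ predT (fun r => ka r) predT) //= sum1_card card_ord.
Qed.

(** The total degree is at most [(p - 1) * N], so the [p] colours cannot all exceed [N]. *)
Let low_degree (k : K) : exists j, (\sum_v expo k j v <= N)%N.
Proof.
apply/existsP; apply: contraT; rewrite negb_exists => /forallP H.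
have : (\sum_(j < p) N.+1 <= \sum_(j < p) \sum_v expo k j v)%N.
  by apply: leq_sum => j _; rewrite ltnNge H.
rewrite sum_nat_const card_ord exchange_big /=.
have : (\sum_v \sum_j expo k j v <= \sum_(v < N) d.+1)%N by apply: leq_sum => v _; exact: expo_sum.
rewrite sum_nat_const card_ord.
by move=> h1 h2; have := leq_trans h2 h1; rewrite leqNgt => /negP[]; nia.
Qed.

Let sel k := xchoose (low_degree k).

Let exv (k : K) : {ffun 'I_N -> 'I_N.+1} := [ffun v => inord (expo k (sel k) v)].

Let exvE k v : exv k v = expo k (sel k) v :> nat.
Proof.
rewrite ffunE inordK // ltnS; apply: leq_trans (xchooseP (low_degree k)).
by rewrite (bigD1 v) //= leq_addr.
Qed.

Let exv_low k : (\sum_v exv k v <= N)%N.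
Proof. by under eq_bigr do rewrite exvE; exact: (xchooseP (low_degree k)). Qed.

Let ex (k : K) : E := exist _ (exv k) (exv_low k).

Let psi (j : 'I_p) (e : E) (i : J) : 'F_p := \prod_v x j i 0 v ^+ (sval e v).

Let sgn (k : K) : 'F_p := \prod_v (if k v is Some _ then -1 else 1).

(* The sign is attached to a colour other than the selected one, whose factor is then
   exactly a monomial. *)
Let other k : 'I_p := if sel k == ord0 then ord_max else ord0.

Let phi (k : K) (j : 'I_p) (i : J) : 'F_p :=
  (if j == other k then sgn k else 1) * \prod_v x j i 0 v ^+ expo k j v.

Let phi_sel k : phi k (sel k) =1 psi (sel k) (ex k).
Proof.
move=> i; rewrite /phi (_ : _ == _ = false) ?mul1r; last first.
  by rewrite /other; case: (eqVneq (sel k) ord0) => [->|/negPf ->].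
by rewrite /psi; apply: eq_bigr => v _; rewrite exvE.
Qed.

Let expansion (g : {ffun 'I_p -> J}) :
  \sum_k \prod_j phi k j (g j) = \prod_v (1 - (\sum_j x j (g j) 0 v) ^+ d.+1).
Proof.
transitivity (\prod_v \sum_(o : option {ffun 'I_d.+1 -> 'I_p})
   if o is Some ka then - \prod_r x (ka r) (g (ka r)) 0 v else 1).
  rewrite bigA_distr_bigA; apply: eq_bigr => k _.
  rewrite /phi big_split /= -big_mkcond big_pred1_eq /sgn exchange_big -big_split /=.
  apply: eq_bigr => v _; rewrite /expo; case: (k v) => [ka|]; last first.
    by rewrite mul1r big1.
  rewrite mulN1r (partition_big (fun r => ka r) predT) //=; congr (- _).
  apply: eq_bigr => j _; rewrite -prodr_const.
  by apply: eq_bigr => r /eqP ->.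
apply: eq_bigr => v _; rewrite (bigD1 None) //=; congr (_ + _).
rewrite (reindex_omap Some id) /=; last by case.
rewrite (eq_bigl predT); last by move=> ka; rewrite /= eqxx.
rewrite sumrN -(bigA_distr_bigA (fun _ j => x j (g j) 0 v)) prodr_const card_ord //.
Qed.

(** By Fermat's little theorem, [1 - y ^ (p - 1)] is 1 at [y = 0] and 0 elsewhere. *)
Let expansion_neq0 (g : {ffun 'I_p -> J}) :
  (\sum_k \prod_j phi k j (g j) != 0) = (\sum_j x j (g j) == 0).
Proof.
rewrite expansion; apply/idP/eqP => [|s0].
  rewrite prodf_seq_neq0 => /allP H; apply/rowP => v.
  rewrite !mxE summxE; apply: contraTeq (H v (mem_index_enum v)) => yn0; rewrite negbK subr_eq0.
  have := expf_card (\sum_j x j (g j) 0 v); rewrite card_Fp // exprS.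
  by move=> /(canRL (mulKf yn0)) ->; rewrite mulVf // eqxx.
rewrite big1 ?oner_eq0 // => v _.
by have /rowP/(_ v) := s0; rewrite summxE mxE => ->; rewrite expr0n subr0.
Qed.

Lemma multicolored_sum_free :
  (forall i, \sum_j x j i = 0) -> (p * 4 ^ N < #|J|)%N ->
  exists g : {ffun 'I_p -> J}, \sum_j x j (g j) = 0 /\ exists i j, g i != g j.
Proof.
move=> diag ltJ.
pose nonconst (g : {ffun 'I_p -> J}) := [exists i, exists j, g i != g j].
have [/existsP[g /andP[/eqP g0 /existsP[i /existsP[j gij]]]]|] :=
  boolP [exists g : {ffun 'I_p -> J}, (\sum_j x j (g j) == 0) && nonconst g].
  by exists g; split=> //; exists i, j.
rewrite negb_exists => /forallP H; exfalso.
have : (#|J| <= p * #|{: E}|)%N.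
  apply: (slice_rank_bound phi_sel) => [g|i].
    rewrite expansion_neq0 => g0 i j; move: (H g); rewrite g0 /= negb_exists => /forallP/(_ i).
    by rewrite negb_exists => /forallP/(_ j); rewrite negbK => /eqP.
  by rewrite expansion_neq0; under eq_bigr do rewrite ffunE; rewrite diag.
have := card_low_degree_exponents N; have := p_prime; nia.
Qed.
End MultiColoredSumFree.

(** * Zero sums involving many indices *)

Lemma card_bigcup_le (I T : finType) (P : pred I) (B : I -> {set T}) :
  (#|\bigcup_(i | P i) B i| <= \sum_(i | P i) #|B i|)%N.
Proof.
elim/big_rec2: _ => [|i s U _ leU]; first by rewrite cards0.
by apply: leq_trans (leq_add (leqnn _) leU); rewrite cardsU leq_subr.
Qed.

Lemma card_small_image (I J : finType) (K : nat) (j0 : J) : (0 < K)%N ->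
  (#|[set g : {ffun I -> J} | #|[set g i | i in I]| <= K]| <= #|J| ^ K * K ^ #|I|)%N.
Proof.
move=> K0.
pose m (vc : {ffun 'I_K -> J} * {ffun I -> 'I_K}) : {ffun I -> J} := [ffun i => vc.1 (vc.2 i)].
have sub : [set g : {ffun I -> J} | (#|[set g i | i in I]| <= K)%N]
    \subset [set m vc | vc : {ffun 'I_K -> J} * {ffun I -> 'I_K}].
  apply/subsetP=> g; rewrite inE => gK.
  pose e := enum [set g i | i in I].
  have lt_e i : (index (g i) e < K)%N.
    apply: leq_trans gK; rewrite cardE index_mem mem_enum; exact: imset_f.
  apply/imsetP; exists ([ffun k : 'I_K => nth j0 e k], [ffun i => Ordinal (lt_e i)]) => //.
  apply/ffunP=> i; rewrite !ffunE /= nth_index // mem_enum; exact: imset_f.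
apply: leq_trans (subset_leq_card sub) _; apply: leq_trans (leq_imset_card _ _) _.
by rewrite card_prod !card_ffun !card_ord.
Qed.

Section RandomLift.
Variables (I J : finType) (V : finZmodType).

Let H := [set f : {ffun I * J -> V} | [forall q, \sum_i f (i, q) == 0]].

(** Adding [D v] preserves the sum over [I] for every fixed second index, but changes the sum along
    [g] by [v], because [g j] differs from [g i]. Hence the translates of the kernel by the [D v]
    are disjoint inside [H]. *)
Let card_kernel (g : {ffun I -> J}) (i j : I) : g i != g j ->
  (#|[set f in H | (\sum_i f (i, g i) == 0)%R]| * #|V| <= #|H|)%N.
Proof.
move=> gij; have ij : i != j by apply: contraNneq gij => ->.
pose D (v : V) : {ffun I * J -> V} := [ffun u : I * J =>
  if u == (i, g i) then v else if u == (j, g i) then - v else 0].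
have DH v q : \sum_k D v (k, q) = 0.
  have [->|qi] := eqVneq q (g i); last first.
    by rewrite big1 // => k _; rewrite ffunE !xpair_eqE (negPf qi) !andbF.
  rewrite (bigD1 i) //= (bigD1 j) 1?eq_sym //= big1 ?addr0.
    by rewrite !ffunE !eqxx xpair_eqE eq_sym (negPf ij) subrr.
  by move=> k /andP[/negPf ki /negPf kj]; rewrite ffunE !xpair_eqE ki kj.
have Dg v : \sum_k D v (k, g k) = v.
  rewrite (bigD1 i) //= big1 ?addr0 => [|k /negPf ki]; first by rewrite ffunE eqxx.
  rewrite ffunE !xpair_eqE ki /=; case: eqP => //= ->.
  by rewrite eq_sym (negPf gij).
rewrite -cardsT -cardsX.
pose m (u : {ffun I * J -> V} * V) : {ffun I * J -> V} := [ffun k => u.1 k + D u.2 k].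
have m_inj : {in setX [set f in H | \sum_i f (i, g i) == 0] [set: V] &, injective m}.
  move=> [f v] [f' v']; rewrite !inE !andbT /= => /andP[_ /eqP f0] /andP[_ /eqP f'0] /ffunP mE.
  have vv : v = v'.
    have : \sum_k m (f, v) (k, g k) = \sum_k m (f', v') (k, g k).
      by apply: eq_bigr => k _; rewrite mE.
    under eq_bigr do rewrite ffunE; under [in RHS]eq_bigr do rewrite ffunE.
    by rewrite !big_split /= f0 f'0 !add0r !Dg.
  subst v'; congr (_, _); apply/ffunP=> k.
  by have := mE k; rewrite !ffunE /= => /addIr.
have <- := card_in_imset m_inj; apply: subset_leq_card.
apply/subsetP => u /imsetP[[f v] + ->{u}]; rewrite !inE andbT /= => /andP[/forallP fH _].
apply/forallP=> q; under eq_bigr do rewrite ffunE /=.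
by rewrite big_split /= (eqP (fH q)) add0r DH.
Qed.

(** A union bound: each [g] rules out at most a proportion [1 / #|V|] of the lifts in [H]. *)
Lemma exists_separating_lift (G : {set {ffun I -> J}}) :
  (#|G| < #|V|)%N -> (forall g, g \in G -> exists i j, g i != g j) ->
  exists f : I -> J -> V, (forall q, \sum_i f i q = 0) /\
    forall g, g \in G -> \sum_i f i (g i) != 0.
Proof.
move=> ltGV Gnc.
have H0 : (0 < #|H|)%N.
  apply/card_gt0P; exists [ffun=> 0]; rewrite inE; apply/forallP=> q.
  by under eq_bigr do rewrite ffunE; rewrite big1.
have [/existsP[f /andP[fH /forallP fG]]|] := boolP [exists f, (f \in H) &&
    [forall g : {ffun I -> J}, (g \in G) ==> (\sum_i f (i, g i) != 0)]].
  exists (fun i q => f (i, q)); split=> [q|g gG].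
    by move: fH; rewrite inE => /forallP/(_ q)/eqP.
  by have := fG g; rewrite gG.
rewrite negb_exists => /forallP H'; exfalso.
have sub : H \subset \bigcup_(g in G) [set f in H | \sum_i f (i, g i) == 0].
  apply/subsetP=> f fH; have := H' f; rewrite fH /= negb_forall => /existsP[g].
  rewrite negb_imply negbK => /andP[gG g0]; apply/bigcupP; exists g => //.
  by rewrite inE fH.
have : (#|H| * #|V| <= #|G| * #|H|)%N.
  apply: (@leq_trans (\sum_(g in G) #|[set f in H | (\sum_i f (i, g i) == 0)%R]| * #|V|)%N).
    rewrite -big_distrl leq_mul2r; apply/orP; right.
    by apply: leq_trans (subset_leq_card sub) _; exact: card_bigcup_le.
  rewrite -sum_nat_const; apply: leq_sum => g /Gnc [i [j gij]]; exact: card_kernel gij.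
by rewrite mulnC leq_pmul2r // leqNgt ltGV.
Qed.
End RandomLift.

(** The sum-free bound in dimension [n + n'] gives a nonconstant [g] whose lifted sum also vanishes.
    The lift was chosen to exclude this for every nonconstant [g] with at most [K] values. *)
Lemma zero_sum_many_indices (p n n' K : nat) (J : finType) (x : 'I_p -> J -> 'rV['F_p]_n) :
  prime p -> (0 < K)%N -> (#|J| ^ K * K ^ p < p ^ n')%N -> (p * 4 ^ (n + n') < #|J|)%N ->
  (forall q, \sum_j x j q = 0) ->
  exists g : {ffun 'I_p -> J}, \sum_j x j (g j) = 0 /\ (K < #|[set g j | j in 'I_p]|)%N.
Proof.
move=> p_prime K0 ltK ltJ diag.
have /card_gt0P[j0 _] : (0 < #|J|)%N by apply: leq_ltn_trans ltJ.
pose G := [set g : {ffun 'I_p -> J} | [exists i, exists j, g i != g j] &&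
  (#|[set g j | j in 'I_p]| <= K)%N].
have ltG : (#|G| < #|'rV['F_p]_n'|)%N.
  rewrite card_mx mul1n card_Fp //; apply: leq_ltn_trans ltK.
  have := card_small_image 'I_p j0 K0; rewrite card_ord; apply: leq_trans.
  by apply: subset_leq_card; apply/subsetP=> g; rewrite !inE => /andP[].
have [|f [f0 fG]] := exists_separating_lift ltG.
  by move=> g; rewrite inE => /andP[/existsP[i /existsP[j]]]; exists i, j.
move: p_prime x f ltJ diag @G ltG f0 fG.
case: p ltK => [|[|d]] // _ p_prime x f ltJ diag G ltG f0 fG.
pose y j q : 'rV_(n + n') := row_mx (x j q) (f j q).
have [|//|g [g0 [i [j gij]]]] := multicolored_sum_free (x := y) p_prime.
  move=> q; rewrite -[LHS]hsubmxK !raddf_sum /=.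
  under eq_bigr do rewrite row_mxKl; rewrite diag.
  under eq_bigr do rewrite row_mxKr; by rewrite f0 row_mx0.
exists g; split.
  have /(congr1 lsubmx) := g0; rewrite raddf_sum raddf0 /=.
  by under eq_bigr do rewrite row_mxKl.
rewrite ltnNge; apply/negP => gK; have := fG g; rewrite inE gK andbT.
have -> : [exists i, exists j, g i != g j] by apply/existsP; exists i; apply/existsP; exists j.
have /(congr1 rsubmx) := g0; rewrite raddf_sum raddf0 /=.
by under eq_bigr do rewrite row_mxKr; move=> ->; rewrite eqxx => /(_ isT).
Qed.

(** * Plunnecke's inequality *)

Definition addset (V : finZmodType) (A B : {set V}) : {set V} := [set x + y | x in A, y in B].
Definition diffset (V : finZmodType) (A : {set V}) : {set V} := [set x - y | x in A, y in A].

Section Plunnecke.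
Variable V : finZmodType.
Implicit Types (A B C X Y : {set V}) (x y : V).

Lemma addsetA : associative (@addset V).
Proof.
move=> A B C; apply/setP=> z; apply/imset2P/imset2P => -[].
  by move=> x _ xA /imset2P[y w yB wC ->] ->; exists (x + y) w => //; [exact: imset2_f|rewrite addrA].
by move=> _ w /imset2P[x y xA yB ->] wC ->; exists x (y + w) => //; [exact: imset2_f|rewrite addrA].
Qed.

Lemma card_addset1 A x : #|addset A [set x]| = #|A|.
Proof.
rewrite /addset imset2_set1r card_imset //; exact: addIr.
Qed.

Lemma leq_card_addset A B : B != set0 -> (#|A| <= #|addset A B|)%N.
Proof.
case/set0Pn=> x xB; rewrite -(card_addset1 A x); apply: subset_leq_card.
by apply: imset2S => //; rewrite sub1set.
Qed.

Lemma addsetUr A B C : addset A (B :|: C) = addset A B :|: addset A C.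
Proof.
apply/setP=> z; rewrite inE; apply/imset2P/orP.
  by case=> x y xA; rewrite inE => /orP[yB|yC] ->; [left|right]; exact: imset2_f.
by case=> /imset2P[x y xA yB ->]; exists x y; rewrite // inE yB ?orbT.
Qed.

(* Petridis: adding c to C enlarges X + B + C by at most |X + B| - |Z + B| elements, and
   X + C by at least |X| - |Z| elements, for the same subset Z of X. *)
Lemma petridis X B C :
  (forall Z : {set V}, Z \subset X -> #|addset X B| * #|Z| <= #|addset Z B| * #|X|)%N ->
  (#|addset (addset X B) C| * #|X| <= #|addset X B| * #|addset X C|)%N.
Proof.
move=> minX; move: {2}#|C| (leqnn #|C|) => n.
elim: n C => [|n IHn] C.
  rewrite leqn0 cards_eq0 => /eqP ->.
  rewrite (_ : addset (addset X B) set0 = set0) ?cards0 //.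
  by apply/setP=> z; rewrite inE; apply/imset2P => -[x y _]; rewrite inE.
have [->|/set0Pn[c cC] leC] := eqVneq C set0; first by move=> _; apply: IHn; rewrite cards0.
have {}/IHn IH : (#|C :\ c| <= n)%N by move: leC; rewrite (cardsD1 c) cC.
set C' := C :\ c in IH.
have defC : C = C' :|: [set c] by rewrite setUC setD1K.
pose Z := [set a in X | addset (addset [set a] B) [set c] \subset addset (addset X B) C'].
pose Y := [set a in X | a + c \in addset X C'].
have YZ : Y \subset Z.
  apply/subsetP=> a; rewrite !inE => /andP[aX /imset2P[x y xX yC ac]]; rewrite aX.
  apply/subsetP=> _ /imset2P[_ _ /imset2P[_ b /set1P -> bB ->] /set1P -> ->].
  by rewrite addrAC ac addrAC; apply: imset2_f => //; exact: imset2_f.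
have ZX : Z \subset X by apply/subsetP=> a; rewrite inE => /andP[].
have YX : Y \subset X by apply: subset_trans ZX.
have ubl : (#|addset (addset X B) C| + #|addset Z B| <= #|addset (addset X B) C'| + #|addset X B|)%N.
  rewrite defC addsetUr.
  set P := addset (addset X B) C'; set Q := addset (addset X B) [set c].
  have sub : addset (addset Z B) [set c] \subset P :&: Q.
    rewrite subsetI; apply/andP; split; last first.
      by apply: imset2S => //; apply: imset2S.
    apply/subsetP=> _ /imset2P[_ _ /imset2P[a b aZ bB ->] /set1P -> ->].
    move: aZ; rewrite inE => /andP[_ /subsetP]; apply.
    by apply: imset2_f; rewrite ?inE //; apply: imset2_f; rewrite ?inE.
  have := subset_leq_card sub; rewrite card_addset1.
  have := cardsUI P Q; rewrite {3}/Q card_addset1; lia.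
have lbr : (#|addset X C'| + #|X| <= #|addset X C| + #|Y|)%N.
  rewrite defC addsetUr.
  set P := addset X C'; set Q := addset X [set c].
  have sub : P :&: Q \subset addset Y [set c].
    apply/subsetP=> z; rewrite inE => /andP[zP /imset2P[a _ aX /set1P -> zac]].
    by rewrite zac; apply: imset2_f; rewrite ?inE // aX -zac.
  have := subset_leq_card sub; rewrite card_addset1.
  have := cardsUI P Q; rewrite {3}/Q card_addset1; lia.
have := minX Z ZX; have := subset_leq_card YZ; have := subset_leq_card YX.
move: IH ubl lbr; have := subset_leq_card ZX.
move: #|addset _ C| #|addset _ C'| #|addset X C| #|addset X C'| #|addset X B| #|addset Z B| #|X| #|Y| #|Z|.
move=> n1 n2 n3 n4 n5 n6 n7 n8 n9 H1 H2 H3 H4 H5 H6 H7.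
have : (n1 * n7 + n6 * n7 <= n2 * n7 + n5 * n7)%N by rewrite -!mulnDl leq_mul2r H3 orbT.
have : (n5 * n4 + n5 * n7 <= n5 * n3 + n5 * n8)%N by rewrite -!mulnDr leq_mul2l H4 orbT.
have : (n5 * n8 <= n5 * n9)%N by rewrite leq_mul2l H6 orbT.
lia.
Qed.

Lemma exists_min_expansion Y B : Y != set0 ->
  exists X, [/\ X != set0, X \subset Y &
    forall Z : {set V}, Z \subset Y -> (#|addset X B| * #|Z| <= #|addset Z B| * #|X|)%N].
Proof.
move=> Y0.
(* The ratio [#|addset X B| / #|X|] to be minimised, scaled to an integer by a factorial that every
   [#|X|] divides. *)
pose f X := (#|addset X B| * (#|[set: V]|`! %/ #|X|))%N.
have [|X /andP[X0 XY] minX] := @arg_minnP _ Y (fun X => (X != set0) && (X \subset Y)) f.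
  by rewrite Y0 subxx.
exists X; split=> // Z ZY.
have [->|Z0] := eqVneq Z set0; first by rewrite cards0 muln0.
have dv (W : {set V}) : W != set0 -> (#|[set: V]|`! %/ #|W| * #|W| = #|[set: V]|`!)%N.
  by move=> W0; apply/divnK/dvdn_fact; rewrite card_gt0 W0 /= subset_leq_card // subsetT.
have := minX Z; rewrite Z0 ZY => /(_ isT); rewrite /f => le1.
have := dv _ X0; have := dv _ Z0; have := fact_gt0 #|[set: V]|.
move: le1; move: (_ %/ _)%N (_ %/ _)%N => q' q le1 f0 eZ eX.
rewrite -(@leq_pmul2r #|[set: V]|`!) //.
rewrite -{1}eX -eZ.
have : (#|addset X B| * q * (#|X| * #|Z|) <= #|addset Z B| * q' * (#|X| * #|Z|))%N by rewrite leq_mul2r le1 orbT.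
by congr (_ <= _)%N; ring.
Qed.

Lemma sumset0 A : sumset 0 A = [set 0].
Proof.
apply/setP=> z; rewrite inE; apply/imsetP/eqP => [[x _ ->]|->]; first by rewrite big_ord0.
exists [ffun=> 0]; last by rewrite big_ord0.
by apply/ffun_onP=> -[].
Qed.

Lemma sumsetS l A : sumset l.+1 A = addset A (sumset l A).
Proof.
apply/setP=> z; apply/imsetP/imset2P => [[x /ffun_onP xA ->]|[a _ aA /imsetP[x /ffun_onP xA ->] ->]].
  exists (x ord0) (\sum_(i < l) [ffun i => x (lift ord0 i)] i) => //.
    by apply: imset_f; apply/ffun_onP=> i; rewrite ffunE.
  by rewrite big_ord_recl; congr (_ + _); apply: eq_bigr => i _; rewrite ffunE.
exists [ffun i => oapp x a (unlift ord0 i)].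
  by apply/ffun_onP=> i; rewrite ffunE; case: unliftP => [j|] _ //=.
rewrite big_ord_recl ffunE unlift_none; congr (_ + _).
by apply: eq_bigr => i _; rewrite ffunE liftK.
Qed.

Lemma card_sumset_opp l A : #|sumset l [set - x | x in A]| = #|sumset l A|.
Proof.
suff -> : sumset l [set - x | x in A] = [set - x | x in sumset l A].
  by rewrite card_imset //; exact: oppr_inj.
elim: l => [|l IHl]; first by rewrite !sumset0 imset_set1 oppr0.
rewrite !sumsetS IHl; apply/setP=> z; apply/imset2P/imsetP.
  case=> _ _ /imsetP[x xA ->] /imsetP[y yA ->] ->.
  by exists (x + y); [exact: imset2_f|rewrite opprD].
case=> _ /imset2P[x y xA yA ->] ->.
by exists (- x) (- y); rewrite ?opprD //; exact: imset_f.
Qed.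

(** With [B = -Y] and [X] of minimal expansion, [petridis] adds the copies of [B] one at a time.
    Each costs the expansion ratio of [X], which is at most that of [Y] itself,
    [#|diffset Y| / #|Y|]. *)
Lemma plunnecke l Y : Y != set0 ->
  (#|sumset l Y| * #|Y| ^ l <= #|diffset Y| ^ l * #|Y|)%N.
Proof.
move=> Y0; pose B := [set - x | x in Y].
have DE : diffset Y = addset Y B.
  apply/setP=> z; apply/imset2P/imset2P => [[x y xY yY ->]|[x _ xY /imsetP[y yY ->] ->]].
    by exists x (- y) => //; exact: imset_f.
  by exists x y.
have [X [X0 XY minX]] := exists_min_expansion B Y0.
have Xgt0 : (0 < #|X|)%N by rewrite card_gt0.
have H m : (#|addset X (sumset m B)| * #|Y| ^ m <= #|diffset Y| ^ m * #|X|)%N.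
  elim: m => [|m IHm]; first by rewrite sumset0 card_addset1 !mul1n muln1.
  have := @petridis X B (sumset m B) (fun Z ZX => minX Z (subset_trans ZX XY)).
  rewrite -addsetA -sumsetS; have := minX Y (subxx _); rewrite -DE => h1 h2.
  rewrite -(@leq_pmul2r #|X|) // !expnS.
  apply: (@leq_trans ((#|addset X B| * #|Y|) * (#|addset X (sumset m B)| * #|Y| ^ m)))%N.
    have : (#|addset X (sumset m.+1 B)| * #|X| * (#|Y| * #|Y| ^ m) <=
      #|addset X B| * #|addset X (sumset m B)| * (#|Y| * #|Y| ^ m))%N by rewrite leq_mul2r h2 orbT.
    by congr (_ <= _)%N; ring.
  have := leq_mul h1 IHm.
  by congr (_ <= _)%N; ring.
rewrite -card_sumset_opp -/B.
have le1 : (#|sumset l B| <= #|addset X (sumset l B)|)%N.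
  have -> : addset X (sumset l B) = addset (sumset l B) X.
    by apply/setP=> z; apply/imset2P/imset2P => -[x y xX yX ->]; exists y x; rewrite // addrC.
  exact: leq_card_addset.
apply: leq_trans (leq_mul le1 (leqnn _)) _; apply: leq_trans (H l) _.
by rewrite leq_mul2l subset_leq_card ?orbT.
Qed.

End Plunnecke.

Local Close Scope ring_scope.
Local Open Scope nat_scope.

(** * Dependent random choice *)

Lemma chebyshev_pair (x y t : nat) : x * y ^ t + y * x ^ t <= x * x ^ t + y * y ^ t.
Proof.
wlog le_xy : x y / x <= y.
  by move=> H; case: (leqP x y) => [/H//|/ltnW/H]; rewrite addnC [X in _ <= X]addnC.
have [->|t0] := posnP t; first by rewrite !expn0.
by have : x ^ t <= y ^ t; [rewrite leq_exp2r | nia].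
Qed.

Lemma power_mean (I : finType) (B : {set I}) (f : I -> nat) t :
  (\sum_(i in B) f i) ^ t.+1 <= #|B| ^ t * \sum_(i in B) f i ^ t.+1.
Proof.
elim: t => [|t IHt]; first by rewrite expn1 mul1n.
rewrite expnS; apply: leq_trans (leq_mul (leqnn _) IHt) _.
rewrite expnS mulnCA [#|B| * _]mulnC -mulnA leq_mul2l; apply/orP; right.
have S (g h : I -> nat) : \sum_(i in B) \sum_(j in B) g i * h j = (\sum_(i in B) g i) * \sum_(j in B) h j.
  by rewrite big_distrl; apply: eq_bigr => i _; rewrite big_distrr.
(* Chebyshev's sum inequality: doubling and symmetrising the double sum reduces it to
   [chebyshev_pair] for each pair of indices. *)
rewrite -(@leq_pmul2l 2) // -S -sum1_card -S.
rewrite !mul2n -!addnn {1}exchange_big -[X in _ <= X + _]exchange_big /= -!big_split /=.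
apply: leq_sum => i _; rewrite -!big_split /=; apply: leq_sum => j _.
by have := chebyshev_pair (f i) (f j) t.+1; rewrite !expnS; lia.
Qed.

Lemma sum_card_fibres (S T : finType) (P : S -> T -> bool) t :
  \sum_(w : {ffun 'I_t -> T}) #|[set x | [forall i, P x (w i)]]| = \sum_x #|[set v | P x v]| ^ t.
Proof.
transitivity (\sum_(w : {ffun 'I_t -> T}) \sum_x ([forall i, P x (w i)] : nat)).
  apply: eq_bigr => w _; rewrite -sum1_card big_mkcond /=.
  by apply: eq_bigr => x _; rewrite inE; case: ifP.
rewrite exchange_big /=; apply: eq_bigr => x _.
have <- : \sum_v (P x v : nat) = #|[set v | P x v]|.
  by rewrite -sum1_card [RHS]big_mkcond; apply: eq_bigr => v _; rewrite inE; case: (P x v).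
rewrite -[X in _ ^ X]card_ord -prod_nat_const.
rewrite (bigA_distr_bigA (fun _ v => P x v : nat)); apply: eq_bigr => w _.
case: (boolP [forall i, P x (w i)]) => [/forallP H|].
  by rewrite big1 // => i _; rewrite H.
by rewrite negb_forall => /existsP[i /negPf Pi]; rewrite (bigD1 i) //= Pi.
Qed.

(** Polynomial density without roots: [b ^ E <= w ^ E * a] says that [w] is at least [b] divided by
    the [E]-th root of [a], so a larger [E] means a denser set. *)
Lemma dense_mono (w b a E E1 : nat) : 0 < a -> 0 < E1 ->
  b ^ (E * E1) <= w ^ (E * E1) * a -> b ^ E <= w ^ E * a.
Proof.
move=> a0 E10; rewrite !expnM => H; rewrite leqNgt -(@ltn_exp2r _ _ E1) // -leqNgt.
rewrite expnMn; apply: leq_trans H _; rewrite leq_mul2l -{1}(expn1 a) leq_pexp2l ?orbT //.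
Qed.

(* Choosing the samples w at random, the common neighbourhood U of a sample keeps a
   polynomial proportion while every pair with few common neighbours is avoided. *)
Lemma dependent_random_choice (T : finType) (B : {set T}) (W : {set T * T}) (a E s : nat) :
  W \subset setX B B -> 0 < E -> 4 ^ E <= a -> a <= #|B| -> #|B| ^ 3 * a ^ 2 <= a ^ s ->
  #|B| ^ (4 * (E * (E * s))) <= #|W| ^ (2 * (E * (E * s))) * a ->
  exists (U : {set T}) (v0 : T), [/\ U \subset B, forall u, u \in U -> (u, v0) \in W,
    #|B| ^ E <= #|U| ^ E * a &
    forall u u', u \in U -> u' \in U ->
      #|B| ^ E <= #|[set v | ((u, v) \in W) && ((u', v) \in W)]| ^ E * a].
Proof.
set b := #|B| => WB E0 aE ab bs dens.
have a1 : 1 < a by apply: leq_trans aE; rewrite -(prednK E0) expnS; have := expn_gt0 4 E.-1; lia.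
have s0 : 0 < s by case: s bs {dens} => // bs; exfalso; move: bs; rewrite expn0 ; nia.
(* With [t] samples, [dens] makes the mean of [#|U w|] at least [b] divided by the [2E]-th root of
   [a], while a bad pair survives with probability below [a ^ -s]. *)
set t := E * s in dens.
have t0 : 0 < t by rewrite muln_gt0 E0.
pose N u u' := [set v | ((u, v) \in W) && ((u', v) \in W)].
pose bad (u : T * T) := #|N u.1 u.2| ^ E * a < b ^ E.
pose U (w : {ffun 'I_t -> T}) := [set u | [forall i, (u, w i) \in W]].
pose Bad (w : {ffun 'I_t -> T}) := [set u : T * T |
  [forall i, bad u && ((u.1, w i) \in W) && ((u.2, w i) \in W)]].
have UB w : U w \subset B.
  apply/subsetP=> u; rewrite inE => /forallP/(_ (Ordinal t0)) /(subsetP WB).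
  by rewrite inE => /andP[].
have sumU : #|W| ^ t <= b ^ t.-1 * \sum_w #|U w|.
  rewrite (sum_card_fibres (fun u v => (u, v) \in W)).
  have WE : #|W| = \sum_(u in B) #|[set v | (u, v) \in W]|.
    rewrite -sum1_card (partition_big (fun u => u.1) (mem B)) /=; last first.
      by move=> u /(subsetP WB); rewrite inE => /andP[].
    apply: eq_bigr => u _; rewrite sum1_card.
    rewrite -(card_imset (mem [set v | (u, v) \in W]) (f := fun v => (u, v))); last by move=> ? ? [].
    apply: eq_card => -[x v]; rewrite unfold_in /=; apply/andP/imsetP.
      by case=> xW /eqP <-; exists v; rewrite ?inE.
    by case=> y; rewrite inE => yW [-> ->].
  rewrite WE -{1}(prednK t0); apply: leq_trans (power_mean _ _ _) _.
  rewrite prednK // leq_mul2l; apply/orP; right.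
  by rewrite big_mkcond /=; apply: leq_sum => u _; case: ifP.
(* There are at most [b ^ 2] bad pairs, and [b ^ 3 * a ^ 2 <= a ^ s] leaves fewer than [1 / b] of
   them on average. *)
have sumBad : (\sum_w #|Bad w|) * b <= b ^ t.
  have -> : \sum_w #|Bad w| = \sum_u #|[set v | bad u && ((u.1, v) \in W) && ((u.2, v) \in W)]| ^ t.
    by rewrite -(sum_card_fibres (fun u v => bad u && ((u.1, v) \in W) && ((u.2, v) \in W))).
  have le1 (u : T * T) : #|[set v | bad u && ((u.1, v) \in W) && ((u.2, v) \in W)]| ^ t * a ^ s <=
      if u \in setX B B then b ^ t else 0.
    case: ifPn => [_|uB].
      case: (boolP (bad u)) => [|_]; last first.
        rewrite (_ : [set _ | _] = set0) ?cards0 ?exp0n ?mul0n //.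
      rewrite /bad /= => /ltnW badu.
      rewrite /t !(expnM _ E) -expnMn leq_exp2r //.
    rewrite (_ : [set _ | _] = set0) ?cards0 ?exp0n ?mul0n //.
    apply/setP=> v; rewrite !inE; apply: contraNF uB => /andP[/andP[_ /(subsetP WB) u1 /(subsetP WB) u2]].
    by move: u1 u2; rewrite !inE => /andP[-> _] /andP[-> _].
  have : (\sum_u #|[set v | bad u && ((u.1, v) \in W) && ((u.2, v) \in W)]| ^ t) * a ^ s <= b ^ 2 * b ^ t.
    rewrite big_distrl /=; apply: leq_trans (leq_sum _ (fun u _ => le1 u)) _.
    by rewrite -big_mkcond sum_nat_const cardsX mulnn.
  move: (\sum_u _) => q qs.
  have : q * (b ^ 3 * a ^ 2) <= b ^ 2 * b ^ t by apply: leq_trans qs; rewrite leq_mul2l bs orbT.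
  have b0 : 0 < b ^ 2 by rewrite expn_gt0; lia.
  rewrite (_ : q * (b ^ 3 * a ^ 2) = b ^ 2 * (q * b * a ^ 2)); last by ring.
  rewrite leq_pmul2l //; apply: leq_trans; rewrite leq_pmulr // expn_gt0; lia.
have [/existsP[w /andP[/eqP Bw Uw]]|noW] :=
  boolP [exists w, (Bad w == set0) && (b ^ E <= #|U w| ^ E * a)].
  exists (U w), (w (Ordinal t0)); split=> //.
    by move=> u; rewrite inE => /forallP.
  move=> u u'; rewrite !inE => /forallP uW /forallP u'W; rewrite leqNgt; apply/negP => badu.
  move/setP: Bw => /(_ (u, u')); rewrite !inE => /negP[]; apply/forallP=> i /=.
  by rewrite uW u'W !andbT.
(* [x] bounds [#|U w|] over samples without bad pairs. The other samples contribute at most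
   [b * #|Bad w|] each, [b ^ t] altogether, so the mean over samples from [B] is at most [x + 1]. *)
exfalso; pose x := \max_(w | Bad w == set0) #|U w|.
have xE : x ^ E * a < b ^ E.
  rewrite /x; case: (pickP (fun w => Bad w == set0)) => [w0 w0P|no]; last first.
    by rewrite big_pred0 // exp0n // mul0n expn_gt0; lia.
  have w0P' : 0 < #|[pred w | Bad w == set0]| by apply/card_gt0P; exists w0.
  have [w wP ->] := eq_bigmax_cond (fun w => #|U w|) w0P'.
  rewrite ltnNge; move: noW; rewrite negb_exists => /forallP/(_ w).
  by move=> /negP noww; apply/negP => Uw; apply: noww; apply/andP; split.
have leU w : #|U w| <= (if w \in ffun_on (mem B) then x else 0) + b * #|Bad w|.
  case: ifPn => [_|wB]; last first.
    rewrite (_ : U w = set0) ?cards0 //; apply/setP=> u; rewrite !inE.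
    apply: contraNF wB => /forallP uW; apply/ffun_onP=> i.
    by have /(subsetP WB) := uW i; rewrite inE => /andP[].
  have [w0|wn0] := eqVneq (Bad w) set0.
    by apply: leq_trans (leq_addr _ _); rewrite /x (bigD1 w) ?w0 //= leq_maxl.
  apply: leq_trans (subset_leq_card (UB w)) _; rewrite -/b -{1}(muln1 b).
  by apply: leq_trans (leq_addl _ _); rewrite leq_mul2l card_gt0 wn0 orbT.
have sumU' : \sum_w #|U w| <= b ^ t * x.+1.
  apply: leq_trans (leq_sum _ (fun w _ => leU w)) _.
  rewrite big_split /= -big_distrr -big_mkcond sum_nat_const /= card_ffun_on card_ord -/b.
  by rewrite mulnS addnC leq_add2r mulnC.
have b0 : 0 < b by lia.
have WX : #|W| ^ t * b <= b ^ (2 * t) * x.+1.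
  apply: (@leq_trans (b ^ t.-1 * (\sum_w #|U w|) * b)); first by rewrite leq_mul2r sumU orbT.
  rewrite mulnAC -expnSr prednK // mul2n -addnn expnD -mulnA leq_mul2l sumU' orbT //.
have key : b ^ (2 * E) <= a * x.+1 ^ (2 * E).
  rewrite -(@leq_pmul2l (b ^ (4 * (E * t)))) ?expn_gt0 ?b0 //.
  apply: (@leq_trans (#|W| ^ (2 * (E * t)) * a * b ^ (2 * E))); first by rewrite leq_mul2r dens orbT.
  have : (#|W| ^ t * b) ^ (2 * E) <= (b ^ (2 * t) * x.+1) ^ (2 * E) by rewrite leq_exp2r //; lia.
  rewrite !expnMn -!expnM (_ : t * (2 * E) = 2 * (E * t)); last by ring.
  rewrite (_ : 2 * t * (2 * E) = 4 * (E * t)); last by ring.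
  rewrite -(@leq_pmul2r a) //; last lia.
  by congr (_ <= _); ring.
move: key xE; case: x {leU sumU' WX} => [|x] key xE.
  move: key; rewrite exp1n muln1; apply/negP; rewrite -ltnNge.
  apply: (@leq_ltn_trans (b ^ 1)); first by rewrite expn1.
  by rewrite ltn_exp2l //; [lia | apply: leq_trans ab].
(* Since the old [x] is positive, [x + 1] is at most [2 * x], and the hypothesis [4 ^ E <= a]
   absorbs the factor. *)
have : x.+2 ^ (2 * E) <= 4 ^ E * x.+1 ^ (2 * E).
  by rewrite -[4]/(2 ^ 2) -expnM -expnMn leq_exp2r; lia.
move: key xE; rewrite !(mulnC 2 E) !(expnM _ E).
move: (b ^ E) (x.+1 ^ E) (x.+2 ^ E) => Bb X Y key xE le2.
have : Bb ^ 2 <= a * (a * X ^ 2).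
  apply: leq_trans key _; rewrite leq_mul2l; apply/orP; right.
  by apply: leq_trans le2 _; rewrite leq_mul2r aE orbT.
by rewrite leqNgt => /negP[]; rewrite (_ : a * _ = (X * a) ^ 2) ?ltn_exp2r //; ring.
Qed.

(* [tup V r] is the type of [2 ^ r]-tuples, stored as a complete binary tree. *)
Fixpoint tup (V : finType) (r : nat) : finType :=
  if r is r'.+1 then (tup V r' * tup V r')%type else V.

Fixpoint tup_in (V : finType) (A : {set V}) r : {set tup V r} :=
  if r is r'.+1 return {set tup V r} then setX (tup_in A r') (tup_in A r') else A.

Fixpoint tup_sum (V : finZmodType) r : tup V r -> V :=
  if r is r'.+1 return tup V r -> V then fun u => (tup_sum u.1 + tup_sum u.2)%R else id.

Lemma card_tup_in (V : finType) (A : {set V}) r : #|tup_in A r| = #|A| ^ 2 ^ r.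
Proof. by elim: r => [|r IHr] /=; rewrite ?expn1 // cardsX IHr -expnD addnn -mul2n expnS. Qed.

(** Averaging fixes the second half of the tuple and the recursion continues in the first half; in
    the end only one entry varies and the fixed ones sum to [v]. *)
Lemma exists_large_fibre (V : finZmodType) (A : {set V}) r (U : {set tup V r}) :
  U \subset tup_in A r ->
  exists (A' : {set V}) (v : V), [/\ A' \subset A,
    #|U| * #|A| <= #|A'| * #|A| ^ 2 ^ r &
    forall a, a \in A' -> (a + v)%R \in [set tup_sum u | u in U]].
Proof.
elim: r U => [|r IHr] /= U UA.
  exists U, 0%R; split=> // a aU; rewrite addr0; apply/imsetP; exists a => //.
have [->|U0] := eqVneq U set0.
  by exists set0, 0%R; rewrite sub0set cards0; split=> // a; rewrite inE.
pose fib (z : tup V r) := [set u | (u, z) \in U].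
have fibA z : fib z \subset tup_in A r.
  by apply/subsetP=> u; rewrite inE => /(subsetP UA); rewrite inE => /andP[].
have [z zP] : exists z, #|U| <= #|fib z| * #|tup_in A r|.
  apply/existsP; apply: contraT; rewrite negb_exists => /forallP H.
  have cardU : #|U| = \sum_(z in tup_in A r) #|fib z|.
    rewrite -sum1_card (partition_big (fun u => u.2) (mem (tup_in A r))) /=; last first.
      by move=> u /(subsetP UA); rewrite inE => /andP[].
    apply: eq_bigr => z _; rewrite sum1_card.
    rewrite -(card_imset (mem (fib z)) (f := fun u => (u, z))); last by move=> ? ? [].
    apply: eq_card => -[x y]; rewrite unfold_in /=; apply/andP/imsetP.
      by case=> xU /eqP <-; exists x; rewrite ?inE.
    by case=> w; rewrite inE => wU [-> ->].
  have Ugt0 : 0 < #|U| by rewrite card_gt0.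
  have Bgt0 : 0 < #|tup_in A r|.
    rewrite lt0n; apply: contraTneq (subset_leq_card UA); rewrite cardsX => ->.
    by rewrite -ltnNge.
  have : #|U| * #|tup_in A r| <= \sum_(z in tup_in A r) #|U|.-1.
    rewrite cardU big_distrl /=; apply: leq_sum => z _; have := H z; lia.
  by rewrite sum_nat_const; nia.
have [A' [v [A'A A'sz A'v]]] := IHr _ (fibA z).
exists A', (v + tup_sum z)%R; split=> //.
  rewrite card_tup_in in zP; rewrite expnS mul2n -addnn expnD mulnA.
  by apply: leq_trans (leq_mul zP (leqnn _)) _; rewrite mulnAC leq_mul2r A'sz orbT.
move=> a /A'v /imsetP[u uU e]; apply/imsetP; exists (u, z); first by move: uU; rewrite inE.
by rewrite addrA e.
Qed.

Lemma sumset_shift (V : finZmodType) (A Y : {set V}) v l :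
  (forall a, a \in A -> (a + v)%R \in Y) -> #|sumset l A| <= #|sumset l Y|.
Proof.
move=> AY; rewrite -(card_imset _ (@addIr _ (v *+ l)%R)); apply: subset_leq_card.
apply/subsetP=> _ /imsetP[_ /imsetP[x /ffun_onP xA ->] ->].
apply/imsetP; exists [ffun i => x i + v]%R.
  by apply/ffun_onP=> i; rewrite ffunE AY.
under [RHS]eq_bigr do rewrite ffunE.
by rewrite big_split /= sumr_const card_ord.
Qed.

(* Unless one of the two halves of W carries a dense set with a markedly smaller set of sums,
   each difference of sums over U has about |X| representations in X - X. *)
Lemma small_sumset_or_smaller_sums (V : finZmodType) (A : {set V}) r (W : {set tup V r.+1}) E e l :
  0 < E -> 0 < e -> 4 ^ E <= #|A| -> W \subset tup_in A r.+1 ->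
  #|A| ^ (2 ^ r.+1 * (2 * (E * (E * (3 * 2 ^ r + 2))))) <=
    #|W| ^ (2 * (E * (E * (3 * 2 ^ r + 2)))) * #|A| ->
  let X := [set tup_sum u | u in W] in
  (exists W' : {set tup V r}, [/\ W' \subset tup_in A r,
     #|A| ^ (2 ^ r * E) <= #|W'| ^ E * #|A| &
     #|[set tup_sum u | u in W']| ^ e * #|A| < #|X| ^ e]) \/
  exists A' : {set V}, [/\ A' \subset A, #|A| ^ E <= #|A'| ^ E * #|A| &
    #|sumset l A'| ^ e <= #|A| ^ (2 * l) * #|X| ^ e].
Proof.
move=> E0 e0 aE WA dens X.
set good := fun W' : {set tup V r} => [&& W' \subset tup_in A r,
  #|A| ^ (2 ^ r * E) <= #|W'| ^ E * #|A| & #|[set tup_sum u | u in W']| ^ e * #|A| < #|X| ^ e].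
have [/existsP[W' /and3P[]]|] := boolP [exists W', good W']; first by left; exists W'.
rewrite negb_exists => /forallP nogood; right.
have large (W' : {set tup V r}) : W' \subset tup_in A r ->
    #|tup_in A r| ^ E <= #|W'| ^ E * #|A| -> #|X| ^ e <= #|[set tup_sum u | u in W']| ^ e * #|A|.
  rewrite card_tup_in -expnM => h1 h2; have := nogood W'; rewrite /good h1 h2 /=.
  by rewrite -leqNgt.
have a1 : 0 < #|A| by apply: leq_trans aE; rewrite expn_gt0.
have [|||U [v0 [UA Uv0 Usz Upair]]] := @dependent_random_choice _ (tup_in A r) W #|A| E (3 * 2 ^ r + 2) WA E0 aE.
- by rewrite card_tup_in -{1}(expn1 #|A|) leq_pexp2l // expn_gt0.
- by rewrite card_tup_in -expnM -expnD mulnC.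
- by move: dens; rewrite card_tup_in -expnM; congr (_ ^ _ <= _); rewrite expnS; ring.
have UneS : U != set0.
  apply: contraTneq Usz => ->; rewrite cards0 exp0n // mul0n -ltnNge expn_gt0 card_tup_in expn_gt0 a1 //.
set Y := [set tup_sum u | u in U].
have Yne : Y != set0 by rewrite imset_eq0.
have YX : #|Y| <= #|X|.
  rewrite -(card_imset _ (@addIr _ (tup_sum v0))); apply: subset_leq_card.
  apply/subsetP=> _ /imsetP[_ /imsetP[u uU ->] ->].
  by apply/imsetP; exists (u, v0); rewrite ?Uv0.
have XY : #|X| ^ e <= #|Y| ^ e * #|A| by exact: large.
pose c d := #|[set x in X | (x - d)%R \in X]|.
(* Each [v] in the common neighbourhood of [u] and [u'] represents the difference as that of the
   sums of [(u, v)] and [(u', v)]. That neighbourhood is dense, so by [large] its sums are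
   numerous. *)
have cP d : d \in diffset Y -> #|X| ^ e <= c d ^ e * #|A|.
  case/imset2P=> _ _ /imsetP[u uU ->] /imsetP[u' u'U ->] ->.
  apply: leq_trans (large _ _ (Upair u u' uU u'U)) _.
    by apply/subsetP=> v; rewrite inE => /andP[/(subsetP WA)]; rewrite inE => /andP[].
  rewrite leq_mul2r leq_exp2r //; apply/orP; right.
  rewrite -(card_imset _ (@addrI _ (tup_sum u))); apply: subset_leq_card.
  apply/subsetP=> _ /imsetP[_ /imsetP[v + ->] ->]; rewrite !inE => /andP[uv u'v].
  apply/andP; split; apply/imsetP; first by exists (u, v).
  by exists (u', v) => //=; rewrite opprB addrC addrA addrNK.
(* [n0] is [#|X|] divided by the [e]-th root of [#|A|], rounded up. *)
have exc : exists n, #|X| ^ e <= n ^ e * #|A| by exists #|Y|.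
pose n0 := ex_minn exc.
have [n0P n0min] : #|X| ^ e <= n0 ^ e * #|A| /\ forall n, #|X| ^ e <= n ^ e * #|A| -> n0 <= n.
  by rewrite /n0; case: ex_minnP.
have DX : #|diffset Y| * n0 <= #|X| ^ 2.
  rewrite -sum_nat_const; apply: (@leq_trans (\sum_(d in diffset Y) c d)).
    by apply: leq_sum => d dY; exact/n0min/cP.
  apply: (@leq_trans (\sum_d \sum_(x in X) ((x - d)%R \in X : nat))).
    rewrite big_mkcond /=; apply: leq_sum => d _; case: ifP => // _.
    rewrite /c -sum1_card big_mkcond [X in _ <= X]big_mkcond /=; apply: leq_sum => x _.
    by rewrite inE; case: (x \in X) => //=; case: ifP.
  rewrite exchange_big /= -mulnn -[X in _ <= X]sum_nat_const; apply: leq_sum => x _.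
  have -> : \sum_d ((x - d)%R \in X : nat) = #|[set d | (x - d)%R \in X]|.
    by rewrite -sum1_card [RHS]big_mkcond; apply: eq_bigr => d _; rewrite inE; case: ifP.
  rewrite -(@card_imset _ _ (fun d => x - d)%R); last by move=> d d' /addrI /oppr_inj.
  by apply: subset_leq_card; apply/subsetP=> _ /imsetP[d + ->]; rewrite inE.
have DXe : #|diffset Y| ^ e <= #|A| * #|X| ^ e.
  have X0 : 0 < #|X| ^ e by rewrite expn_gt0; apply/orP; left; apply: leq_trans YX; rewrite card_gt0.
  rewrite -(leq_pmul2r X0); apply: leq_trans (leq_mul (leqnn _) n0P) _.
  rewrite mulnA -expnMn; apply: (@leq_trans ((#|X| ^ 2) ^ e * #|A|)).
    by rewrite leq_mul2r leq_exp2r // DX orbT.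
  by rewrite -expnM mulnC mul2n -addnn expnD mulnA.
have [A' [v [A'A A'sz A'Y]]] := exists_large_fibre UA.
exists A'; split=> //.
  move: Usz; rewrite card_tup_in => Usz.
  rewrite -(@leq_pmul2l ((#|A| ^ 2 ^ r) ^ E)) ?expn_gt0 ?a1 // -expnMn.
  apply: (@leq_trans ((#|U| * #|A|) ^ E * #|A|)).
    by rewrite !expnMn mulnAC leq_mul2r Usz orbT.
  apply: (@leq_trans ((#|A'| * #|A| ^ 2 ^ r) ^ E * #|A|)); first by rewrite leq_mul2r leq_exp2r // A'sz orbT.
  by rewrite expnMn -mulnA mulnCA leqnn.
apply: leq_trans (_ : #|sumset l Y| ^ e <= _).
  by rewrite leq_exp2r //; exact: sumset_shift A'Y.
have Y0 : 0 < #|Y| by rewrite card_gt0.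
(* By [DXe] and [XY] the [e]-th power of [#|diffset Y| / #|Y|] is at most [#|A| ^ 2]; its [l]-th
   power gives the factor [#|A| ^ (2 * l)]. *)
have := plunnecke l Yne; rewrite -(@leq_exp2r _ _ e) // !expnMn => pl.
rewrite -(@leq_pmul2r ((#|Y| ^ l) ^ e)) ?expn_gt0 ?Y0 //.
apply: leq_trans pl _.
rewrite [_ * #|X| ^ e]mulnC -mulnA [X in _ <= X]mulnC; apply: leq_mul; last by rewrite leq_exp2r.
have -> : (#|Y| ^ l) ^ e = (#|Y| ^ e) ^ l by rewrite -!expnM mulnC.
rewrite -expnM mulnC expnM; apply: (@leq_trans ((#|A| * (#|Y| ^ e * #|A|)) ^ l)).
  case: l => // l; rewrite leq_exp2r //; apply: leq_trans DXe _.
  by rewrite leq_mul2l XY orbT.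
by rewrite expnM -expnMn; apply: eq_leq; congr (_ ^ _); rewrite -mulnn; ring.
Qed.

(* The case where the sums get smaller can occur at most r times. *)
Lemma exists_small_sumset (e l r E : nat) : 0 < e -> 0 < E ->
  exists E0 a0 : nat, 0 < E0 /\
  forall (V : finZmodType) (A : {set V}) (W : {set tup V r}),
    a0 <= #|A| -> W \subset tup_in A r -> #|A| ^ (2 ^ r * E0) <= #|W| ^ E0 * #|A| ->
    #|[set tup_sum u | u in W]| ^ e < #|A| ^ r ->
    exists A' : {set V}, [/\ A' \subset A, #|A| ^ E <= #|A'| ^ E * #|A| &
      #|sumset l A'| ^ e <= #|A| ^ (2 * l) * #|[set tup_sum u | u in W]| ^ e].
Proof.
move=> e0; elim: r E => [|r IHr] E Egt0.
  exists 1, 1; split=> // V A W A1 WA; rewrite expn0 muln1 !expn1 => dens.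
  rewrite ltnS leqn0 expn_eq0 e0 andbT cards_eq0 imset_eq0 => /eqP W0.
  by move: dens; rewrite W0 cards0 mul0n; lia.
have [E1 [a1 [E10 IH]]] := IHr E Egt0.
(* The product serves both outcomes: [dense_mono] lowers it to [E1] for the recursive call and to
   [E] for the conclusion. *)
pose E2 := E * E1; have E20 : 0 < E2 by rewrite muln_gt0 Egt0.
exists (2 * (E2 * (E2 * (3 * 2 ^ r + 2)))), (maxn a1 (4 ^ E2)); split; first by rewrite !muln_gt0 Egt0 E10 addn2.
move=> V A W; rewrite geq_max => /andP[aA EA] WA dens ltW.
have a0 : 0 < #|A| by apply: leq_trans EA; rewrite expn_gt0.
case: (small_sumset_or_smaller_sums l E20 e0 EA WA dens).
  move=> [W' [W'A dW' ltW']].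
  have [||A' [A'A A'sz A'l]] := IH V A W' aA W'A.
  - rewrite expnM; apply: (@dense_mono _ _ _ _ E) => //.
    by rewrite -expnM [E1 * E]mulnC.
  - by rewrite -(@ltn_pmul2r #|A|) // -expnSr; apply: ltn_trans ltW.
  exists A'; split=> //; apply: leq_trans A'l _; rewrite leq_mul2l; apply/orP; right.
  by apply: leq_trans (ltnW ltW'); rewrite leq_pmulr.
move=> [A' [A'A A'sz A'l]]; exists A'; split=> //.
exact: dense_mono a0 E10 A'sz.
Qed.

(** * Sunflowers *)

Lemma card_partition_fibres (S T : finType) (f : S -> T) (A : {set S}) (D : {set T}) :
  (forall x, x \in A -> f x \in D) -> #|A| = \sum_(y in D) #|[set x in A | f x == y]|.
Proof.
move=> AD; rewrite -sum1_card (partition_big f (mem D)) //=; apply: eq_bigr => y _.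
by rewrite -sum1_card; apply: eq_bigl => x; rewrite inE.
Qed.

Lemma exists_large_class (S T : finType) (f : S -> T) (A : {set S}) : A != set0 ->
  exists y, #|A| <= #|T| * #|[set x in A | f x == y]|.
Proof.
case/set0Pn=> x0 x0A; apply/existsP; apply: contraT; rewrite negb_exists => /forallP H.
have T0 : 0 < #|T| by apply/card_gt0P; exists (f x0).
have A0 : 0 < #|A| by apply/card_gt0P; exists x0.
have : #|T| * #|A| <= \sum_(y in [set: T]) #|A|.-1.
  rewrite {1}(@card_partition_fibres _ _ f A [set: T]) // big_distrr /=.
  by apply: leq_sum => y _; rewrite -ltnS prednK // ltnNge H.
by rewrite sum_nat_const cardsT leq_pmul2l // => leA; move: (prednK A0) leA; case: #|A| => //= m _; rewrite ltnn.
Qed.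

(** The argument of Erdos and Rado with positions kept apart, so that the kernel is a set of
    positions. If a maximal subfamily disagreeing throughout [D] has fewer than [q] members, every
    tuple agrees with a member somewhere in [D]; there are at most [k * q] such agreements, and the
    most popular one is fixed and removed from [D]. *)
Lemma sunflower (I : finType) (k q : nat) (F : {set {ffun 'I_k -> I}}) : 0 < q ->
  (k * q) ^ k < #|F| ->
  exists (G : {set {ffun 'I_k -> I}}) (Ker : {set 'I_k}), [/\ G \subset F, q <= #|G| &
    forall u v, u \in G -> v \in G -> u != v -> forall i, (u i == v i) = (i \in Ker)].
Proof.
move=> q0; suff: forall n (D : {set 'I_k}) (F : {set {ffun 'I_k -> I}}), #|D| = n ->
    (forall u v i, u \in F -> v \in F -> i \notin D -> u i = v i) -> (k * q) ^ n < #|F| ->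
  exists (G : {set {ffun 'I_k -> I}}) (Ker : {set 'I_k}), [/\ G \subset F, q <= #|G| &
    forall u v, u \in G -> v \in G -> u != v -> forall i, (u i == v i) = (i \in Ker)].
  move=> H; apply: (H k [set: 'I_k]); first by rewrite cardsT card_ord.
  by move=> u v i; rewrite inE.
elim=> [|n IHn] D {}F.
  move=> /eqP; rewrite cards_eq0 => /eqP -> agree; rewrite expn0 => /card_gt1P[u [v [uF vF /eqP[]]]].
  by apply/ffunP=> i; apply: agree; rewrite ?inE.
move=> Dn agree ltF.
pose good (G : {set {ffun 'I_k -> I}}) := (G \subset F) &&
  [forall u in G, forall v in G, (u != v) ==> [forall i in D, u i != v i]].
have good0 : good set0.
  by rewrite /good sub0set; apply/forallP=> u; rewrite inE.
have [G /maxsetP[/andP[GF /forall_inP Gpair] Gmax] _] := maxset_exists good0.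
have Gpair' u v i : u \in G -> v \in G -> u != v -> i \in D -> u i != v i.
  by move=> uG vG uv iD; move/forall_inP: (Gpair u uG) => /(_ v vG); rewrite uv => /forall_inP/(_ i iD).
have [qG|Gq] := leqP q #|G|.
  exists G, (~: D); split=> // u v uG vG uv i; rewrite inE.
  have [iD|iD] := boolP (i \in D); last by apply/eqP/agree; rewrite ?(subsetP GF).
  by rewrite (negPf (Gpair' _ _ _ uG vG uv iD)).
have /card_gt0P[i0 i0D] : 0 < #|D| by rewrite Dn.
have hit u : u \in F -> exists v, exists2 i, v \in G /\ i \in D & u i = v i.
  move=> uF; have [uG|uG] := boolP (u \in G); first by exists u, i0.
  have [/existsP[v /existsP[i /and3P[vG iD /eqP uv]]]|] :=
    boolP [exists v, exists i, [&& v \in G, i \in D & u i == v i]]; first by exists v, i.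
  rewrite negb_exists => /forallP no; exfalso.
  have noP v i : v \in G -> i \in D -> u i != v i.
    move=> vG iD; have := no v; rewrite negb_exists => /forallP/(_ i).
    by rewrite vG iD.
  have := Gmax (u |: G); rewrite subsetUr; move=> /(_ _ isT) eqG.
  move: uG; rewrite -eqG ?setU11 // /good subUset sub1set uF GF /=.
  apply/forall_inP=> v; rewrite !inE => /orP[/eqP ->|vG]; apply/forall_inP=> w; rewrite !inE.
    case/orP=> [/eqP ->|wG]; first by rewrite eqxx.
    by apply/implyP=> _; apply/forall_inP=> i iD; exact: noP.
  case/orP=> [/eqP ->|wG]; apply/implyP=> vw; apply/forall_inP=> i iD; last exact: Gpair'.
  by rewrite eq_sym; exact: noP.
pose Fvi v i := [set u in F | u i == v i].
have [v [i [vG iD ltFvi]]] : exists v i, [/\ v \in G, i \in D & (k * q) ^ n < #|Fvi v i|].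
  have [/existsP[v /existsP[i /and3P[]]]|] :=
    boolP [exists v, exists i, [&& v \in G, i \in D & (k * q) ^ n < #|Fvi v i|]]; first by exists v, i.
  rewrite negb_exists => /forallP no; exfalso.
  have sub : F \subset \bigcup_(v in G) \bigcup_(i in D) Fvi v i.
    apply/subsetP=> u uF; have [v [i [vG iD uv]]] := hit u uF.
    by apply/bigcupP; exists v => //; apply/bigcupP; exists i => //; rewrite inE uF uv eqxx.
  have : #|F| <= \sum_(v in G) \sum_(i in D) (k * q) ^ n.
    apply: leq_trans (subset_leq_card sub) _; apply: leq_trans (card_bigcup_le _ _) _.
    apply: leq_sum => v vG; apply: leq_trans (card_bigcup_le _ _) _; apply: leq_sum => i iD.
    by have := no v; rewrite negb_exists => /forallP/(_ i); rewrite vG iD -leqNgt.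
  rewrite !sum_nat_const leqNgt => /negP[]; apply: leq_ltn_trans ltF.
  rewrite expnS mulnA [k * q]mulnC leq_mul2r; apply/orP; right.
  by apply: leq_mul; [exact: ltnW | rewrite -[X in _ <= X]card_ord max_card].
have [||G' [Ker [G'F qG' G'P]]] := IHn (D :\ i) (Fvi v i) _ _ ltFvi.
- by move: Dn; rewrite (cardsD1 i) iD; case.
- move=> u w j; rewrite !inE => /andP[uF /eqP ui] /andP[wF /eqP wi].
  rewrite negb_and negbK => /orP[/eqP ->|jD]; first by rewrite ui wi.
  exact: agree.
exists G', Ker; split=> //; apply: subset_trans G'F _.
by apply/subsetP=> u; rewrite inE => /andP[].
Qed.

(** * Extremal families of zero sums *)

Section ZeroSums.
Variables (p : nat) (V : finZmodType).
Implicit Types (A B : {set V}) (F G : {set {ffun 'I_p -> V}}) (w : {ffun 'I_p -> V}).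

Definition im w : {set V} := [set w i | i in 'I_p].

Definition zero_sums A : {set {ffun 'I_p -> V}} :=
  [set w in ffun_on (mem A) | \sum_i w i == 0]%R.

Definition disjoint_family F :=
  [forall w in F, forall w' in F, (w != w') ==> [disjoint im w & im w']].

Lemma disjoint_familyP F : reflect
  (forall w w' x, w \in F -> w' \in F -> x \in im w -> x \in im w' -> w = w')
  (disjoint_family F).
Proof.
apply: (iffP idP) => [H w w' x wF w'F xw xw'|H].
  apply/eqP; apply: contraT => ww'; move/forall_inP: H => /(_ w wF)/forall_inP/(_ w' w'F).
  by rewrite ww' disjoint_subset => /subsetP/(_ x xw); rewrite inE xw'.
apply/forall_inP=> w wF; apply/forall_inP=> w' w'F; apply/implyP; apply: contraNT.
by move/pred0Pn=> [x /andP[xw xw']]; apply/eqP/(H w w' x).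
Qed.

Lemma mem_zero_sums A w : (w \in zero_sums A) = (im w \subset A) && (\sum_i w i == 0)%R.
Proof.
rewrite inE; congr (_ && _); apply/ffun_onP/subsetP => [wA _ /imsetP[i _ ->]|wA i]; first exact: wA.
by apply: wA; exact: imset_f.
Qed.

Lemma card_im_le w : #|im w| <= p.
Proof. by apply: leq_trans (leq_imset_card _ _) _; rewrite card_ord. Qed.

Lemma zero_sumsS A B : A \subset B -> zero_sums A \subset zero_sums B.
Proof.
by move=> AB; apply/subsetP=> w; rewrite !mem_zero_sums => /andP[wA ->]; rewrite (subset_trans wA).
Qed.

Lemma stuck_system A : 0 < p -> A != set0 ->
  (forall x, x \in A -> (x *+ p = 0)%R) ->
  (forall w, w \in zero_sums A -> #|im w| < p) ->
  exists s B F (e : {ffun 'I_p * 'I_p -> bool}),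
    [/\ s < p, B \subset A, F \subset zero_sums B,
        #|A| <= 2 * (2 * p) ^ p * 2 ^ (p * p) * #|F| & disjoint_family F] /\
    [/\ forall w, w \in F -> #|im w| = s,
        forall w i j, w \in F -> (w i == w j) = e (i, j) &
        forall w, w \in zero_sums B -> #|im w| <= s].
Proof.
move=> p0 A0 Ap noA.
have Agt0 : 0 < #|A| by rewrite card_gt0.
(* The factor [2 * p] lost per level pays for the cleaning: when level [s.+1] fails, a maximal
   family [G] there has [2 * p * #|G| < #|F|], and its at most [p * #|G|] entries meet fewer than
   half of the disjoint tuples of [F]. *)
pose fam s F := [&& F \subset zero_sums A, disjoint_family F,
  [forall w in F, s <= #|im w|] & #|A| <= #|F| * (2 * p) ^ s].
pose good s := [exists F, fam s F].
have ex0 : exists s, good s.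
  (* Constant tuples have sum [x *+ p = 0] and start the search. *)
  exists 0; apply/existsP; exists [set [ffun=> x] | x in A].
  apply/and4P; split; last 2 first.
  - by apply/forall_inP.
  - rewrite expn0 muln1 card_in_imset // => x y _ _ /ffunP/(_ (Ordinal p0)).
    by rewrite !ffunE.
  - apply/subsetP=> _ /imsetP[x xA ->]; rewrite mem_zero_sums; apply/andP; split.
      by apply/subsetP=> _ /imsetP[i _ ->]; rewrite ffunE.
    by under eq_bigr do rewrite ffunE; rewrite sumr_const card_ord Ap.
  - apply/disjoint_familyP=> _ _ x /imsetP[y yA ->] /imsetP[z zA ->].
    by case/imsetP=> i _ ->; case/imsetP=> j _; rewrite !ffunE => ->.
have bound s : good s -> s <= p.
  case/existsP=> F /and4P[FA _ /forall_inP Fs leA].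
  have /card_gt0P[w wF] : 0 < #|F| by rewrite lt0n; apply: contraTneq leA => ->; rewrite -ltnNge.
  exact: leq_trans (Fs w wF) (card_im_le w).
case: (ex_maxnP ex0 bound) => s /existsP[F /and4P[FA Fdis /forall_inP Fs leA]] smax.
pose goodG G := [&& G \subset zero_sums A, disjoint_family G & [forall w in G, s < #|im w|]].
have goodG0 : goodG set0.
  apply/and3P; split; first exact: sub0set.
  - by apply/disjoint_familyP=> w w' x; rewrite inE.
  - by apply/forall_inP=> w; rewrite inE.
have [G /maxsetP[/and3P[GA /disjoint_familyP Gdis /forall_inP Gs] Gmax] _] := maxset_exists goodG0.
have leG : 2 * p * #|G| < #|F|.
  have : #|G| * (2 * p) ^ s.+1 < #|A|.
    rewrite ltnNge; apply/negP => leAG.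
    have /smax : good s.+1.
      apply/existsP; exists G; apply/and4P; split=> //; first exact/disjoint_familyP.
      exact/forall_inP.
    by rewrite ltnn.
  move=> lt1; have := leq_trans lt1 leA; rewrite expnS mulnA ltn_pmul2r ?expn_gt0; last lia.
  by rewrite mulnC.
pose U := \bigcup_(w in G) im w.
have cardU : #|U| <= p * #|G|.
  apply: leq_trans (card_bigcup_le _ _) _; rewrite mulnC -sum_nat_const.
  by apply: leq_sum => w _; exact: card_im_le.
pose B := A :\: U.
have BA : B \subset A by exact: subsetDl.
pose F1 := [set w in F | im w \subset B].
have cardF1 : #|F| <= 2 * #|F1|.
  have : #|F :\: F1| <= #|U|.
    pose h w := odflt 0%R [pick x in im w | x \in U].
    have hP w : w \in F :\: F1 -> h w \in im w /\ h w \in U.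
      rewrite !inE negb_and => /andP[/orP[/negP//|wB] wF].
      rewrite /h; case: pickP => [x /andP[//]|no].
      case/negP: wB; rewrite subsetD; apply/andP; split.
        by have := subsetP FA w wF; rewrite mem_zero_sums => /andP[].
      by apply/pred0P => x; exact: no.
    rewrite -(@card_in_imset _ _ h).
      by apply: subset_leq_card; apply/subsetP=> _ /imsetP[w wF ->]; have [] := hP w wF.
    move=> w w' wF w'F hw; have [h1 _] := hP w wF; have [h2 _] := hP w' w'F.
    move: wF w'F; rewrite !inE => /andP[_ wF] /andP[_ w'F].
    by apply: (disjoint_familyP _ Fdis w w' (h w)) => //; rewrite hw.
  have F1F : F1 \subset F by apply/subsetP=> w; rewrite inE => /andP[].
  have := cardsID F1 F; rewrite (setIidPr F1F); lia.
have Bmax w : w \in zero_sums B -> #|im w| <= s.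
  move=> wB; rewrite leqNgt; apply/negP => sw.
  have wG : w \notin G.
    apply/negP=> wG; move: wB; rewrite mem_zero_sums subsetD => /andP[/andP[_]].
    have /card_gt0P[x xw] : 0 < #|im w| by apply: leq_ltn_trans sw.
    rewrite disjoint_subset => /subsetP/(_ x xw); rewrite inE => /negP[].
    by apply/bigcupP; exists w.
  have := Gmax (w |: G); rewrite subsetUr => /(_ _ isT) eqG.
  move: wG; rewrite -eqG ?setU11 //; apply/and3P; split.
  - by rewrite subUset sub1set (subsetP (zero_sumsS BA)).
  - have wU u x : u \in G -> x \in im w -> x \in im u -> False.
      move=> uG xw xu; move: wB; rewrite mem_zero_sums subsetD disjoint_subset => /andP[/andP[_ /subsetP H _]].
      by have := H x xw; rewrite inE => /negP[]; apply/bigcupP; exists u.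
    apply/disjoint_familyP=> u u' x; rewrite !inE => /orP[/eqP ->|uG] /orP[/eqP ->|u'G] // xu xu'.
    + by case: (wU u' x).
    + by case: (wU u x).
    + exact: Gdis xu xu'.
  - by apply/forall_inP=> u; rewrite !inE => /orP[/eqP ->|/Gs].
(* Freezing the equality pattern lets entries of different tuples be compared position by position;
   it costs the factor [2 ^ (p * p)]. *)
pose pat w : {ffun 'I_p * 'I_p -> bool} := [ffun ij => w ij.1 == w ij.2].
have F1gt0 : 0 < #|F1| by lia.
have [|e leF1] := exists_large_class pat (A := F1); first by rewrite -card_gt0.
have sp : s < p.
  have /card_gt0P[w] := F1gt0; rewrite inE => /andP[wF _].
  exact: leq_ltn_trans (Fs w wF) (noA w (subsetP FA w wF)).
exists s, B, [set w in F1 | pat w == e], e; split; split=> //.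
- apply/subsetP=> w; rewrite mem_zero_sums !inE => /andP[/andP[wF ->] _].
  by have := subsetP FA w wF; rewrite mem_zero_sums => /andP[].
- move: leF1; rewrite card_ffun card_bool card_prod card_ord.
  set x := #|[set w in F1 | _]| => leF1.
  have ple : (2 * p) ^ s <= (2 * p) ^ p by rewrite leq_exp2l ?(ltnW sp) //; lia.
  apply: leq_trans leA _; apply: leq_trans (leq_mul (leq_trans cardF1 (leq_mul (leqnn 2) leF1)) ple) _.
  by apply: eq_leq; ring.
- apply/disjoint_familyP=> w w' x; rewrite !inE => /andP[/andP[wF _] _] /andP[/andP[w'F _] _].
  exact: (disjoint_familyP _ Fdis).
- move=> w; rewrite !inE => /andP[/andP[wF wB] _]; apply/eqP; rewrite eqn_leq Fs // andbT.
  apply: Bmax; rewrite mem_zero_sums wB; have := subsetP FA w wF.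
  by rewrite mem_zero_sums => /andP[].
- by move=> w i j; rewrite !inE => /andP[_ /eqP <-]; rewrite ffunE.
Qed.
End ZeroSums.

(** * Exchange argument inside an extremal family *)

Section Stuck.
Variables (p : nat) (V : finZmodType) (s : nat) (B : {set V}) (F : {set {ffun 'I_p -> V}}).
Variable (e : {ffun 'I_p * 'I_p -> bool}).
Hypotheses (sp : s < p) (FB : F \subset zero_sums p B) (Fdis : disjoint_family F).
Hypotheses (Fs : forall w, w \in F -> #|im w| = s).
Hypotheses (Fe : forall w i j, w \in F -> (w i == w j) = e (i, j)).
Hypotheses (Bmax : forall w, w \in zero_sums p B -> #|im w| <= s).

Let F_inj w w' i j : w \in F -> w' \in F -> w i = w' j -> w = w' /\ e (i, j).
Proof.
move=> wF w'F eq; have ww' : w = w'.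
  by apply: (disjoint_familyP _ Fdis w w' (w i)) => //; [exact: imset_f | rewrite eq; exact: imset_f].
by split=> //; rewrite -(Fe _ _ wF) eq ww'.
Qed.

Let FBw w i : w \in F -> w i \in B.
Proof.
move=> wF; have := subsetP FB w wF; rewrite mem_zero_sums => /andP[/subsetP wB _].
by apply: wB; exact: imset_f.
Qed.

(** By disjointness, equal entries of the recombination come from one tuple of [F] at equivalent
    positions. So representatives of the [s] classes of [e] already give [s] values, and [Bmax]
    allows no more: every entry equals that of a representative, which forces [g] to be constant on
    classes. *)
Let diagonal (g : 'I_p -> {ffun 'I_p -> V}) :
  (forall k, g k \in F) -> (\sum_k g k k = 0)%R ->
  #|im [ffun k => g k k]| = s /\ forall i j, e (i, j) -> g i = g j.
Proof.
move=> gF g0; set v : {ffun 'I_p -> V} := [ffun k => g k k].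
have vB : v \in zero_sums p B.
  rewrite mem_zero_sums; apply/andP; split.
    by apply/subsetP=> _ /imsetP[k _ ->]; rewrite ffunE FBw.
  by under eq_bigr do rewrite ffunE; apply/eqP.
pose i0 := Ordinal (leq_ltn_trans (leq0n s) sp); pose w := g i0.
have wF : w \in F by exact: gF.
pose h x := odflt i0 [pick k | w k == x].
have hP x : x \in im w -> w (h x) = x.
  by case/imsetP=> k _ ->; rewrite /h; case: pickP => [l /eqP //|/(_ k)]; rewrite eqxx.
pose R := h @: im w.
have hR r : r \in R -> h (w r) = r by case/imsetP=> x xim ->; rewrite hP.
have vE k l : v k = v l -> g k = g l /\ w k = w l.
  by rewrite !ffunE => /(F_inj (gF k) (gF l)) [-> ekl]; split=> //; apply/eqP; rewrite Fe.
have v_inj : {in R &, injective v}.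
  by move=> r r' rR r'R /vE[_ err]; rewrite -(hR r) // err hR.
have h_inj : {in im w &, injective h} by move=> x y xim yim hxy; rewrite -(hP x) // hxy hP.
have cardR : #|v @: R| = s by rewrite (card_in_imset v_inj) (card_in_imset h_inj) Fs.
have sub : v @: R \subset im v by apply/subsetP=> _ /imsetP[r _ ->]; exact: imset_f.
have imv : v @: R = im v by apply/eqP; rewrite eqEcard sub cardR Bmax.
split=> [|i j eij]; first by rewrite -imv.
have key k : g k = g (h (w k)).
  have : v k \in v @: R by rewrite imv; exact: imset_f.
  by case/imsetP=> r rR /vE[-> ->]; rewrite hR.
by rewrite (key i) (key j); congr (g (h _)); apply/eqP; rewrite Fe.
Qed.

Lemma same_index (g : 'I_p -> {ffun 'I_p -> V}) i j :
  (forall k, g k \in F) -> (\sum_k g k k = 0)%R -> e (i, j) -> g i = g j.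
Proof. by move=> gF g0; have [_] := diagonal gF g0; exact. Qed.

Variables (K : nat) (pos : {ffun 'I_K.+1 -> 'I_p}) (j1 : 'I_p).
Hypotheses (pos_j1 : pos ord0 != j1) (e_j1 : e (pos ord0, j1)).

(* The index tuples, at the positions [pos], of zero-sum combinations; the element at
   position [pos ord0] occurs at least twice in such a combination. *)
Definition solution_tuples : {set {ffun 'I_K.+1 -> {ffun 'I_p -> V}}} :=
  [set t : {ffun 'I_K.+1 -> {ffun 'I_p -> V}} | injectiveb t && [exists g : {ffun 'I_p -> {ffun 'I_p -> V}},
     [&& [forall j, g j \in F], (\sum_j g j j == 0)%R & [forall k, g (pos k) == t k]]]].

Let solutionP (t : {ffun 'I_K.+1 -> {ffun 'I_p -> V}}) : t \in solution_tuples -> injective t /\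
  exists g : 'I_p -> {ffun 'I_p -> V}, [/\ forall j, g j \in F, (\sum_j g j j = 0)%R &
    forall k, g (pos k) = t k].
Proof.
rewrite inE => /andP[/injectiveP t_inj /existsP[g /and3P[/forallP gF /eqP g0 /forallP gt]]].
by split=> //; exists g; split=> // k; apply/eqP.
Qed.

Let solutionF (t : {ffun 'I_K.+1 -> {ffun 'I_p -> V}}) k : t \in solution_tuples -> t k \in F.
Proof. by case/solutionP=> _ [g [gF _ <-]]. Qed.

Let pos_class (t : {ffun 'I_K.+1 -> {ffun 'I_p -> V}}) k l : t \in solution_tuples -> e (pos k, pos l) -> k = l.
Proof.
case/solutionP=> t_inj [g [gF g0 gt]] ekl; apply: t_inj.
by rewrite -!gt; exact: same_index.
Qed.

(** Trading the petal of [t0] for that of another [t] keeps the sum zero. Petals are disjoint, so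
    [p < #|G|] provides one that misses [im v]: it brings in [#|~: Ker|] new values. At most
    [#|~: Ker| - 1] values are lost, since the one at [pos ord0] survives at [j1]. The result has
    more than [s] distinct entries. *)
Lemma no_sunflower (G : {set {ffun 'I_K.+1 -> {ffun 'I_p -> V}}}) (Ker : {set 'I_K.+1}) z :
  G \subset solution_tuples -> p < #|G| -> ord0 \notin Ker ->
  (forall t, t \in G -> (\sum_k t k (pos k) = z)%R) ->
  (forall t u, t \in G -> u \in G -> t != u -> forall k, (t k == u k) = (k \in Ker)) -> False.
Proof.
move=> GZ pG K0 Gz GK.
have /card_gt0P[t0 t0G] : 0 < #|G| by apply: leq_ltn_trans pG.
have t0Z := subsetP GZ t0 t0G; have [t0_inj [g [gF g0 gt]]] := solutionP t0Z.
pose v : {ffun 'I_p -> V} := [ffun k => g k k].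
have vB : v \in zero_sums p B.
  rewrite mem_zero_sums; apply/andP; split.
    by apply/subsetP=> _ /imsetP[k _ ->]; rewrite ffunE FBw.
  by under eq_bigr do rewrite ffunE; apply/eqP.
have vpos k : v (pos k) = t0 k (pos k) by rewrite ffunE gt.
pose petal (t : {ffun 'I_K.+1 -> {ffun 'I_p -> V}}) := [set t k (pos k) | k in ~: Ker].
have petal_inj t u k l : t \in G -> u \in G -> t k (pos k) = u l (pos l) -> k = l /\ t k = u k.
  move=> tG uG /(F_inj (solutionF k (subsetP GZ t tG)) (solutionF l (subsetP GZ u uG))) [].
  by move=> tu /(pos_class t0Z) kl; rewrite -kl in tu.
have [t tG [tt0 tv]] : exists2 t, t \in G & t != t0 /\ [disjoint petal t & im v]. 
  have [/existsP[t /and3P[]]|] := boolP [exists t, [&& t \in G, t != t0 & [disjoint petal t & im v]]].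
    by move=> *; exists t.
  rewrite negb_exists => /forallP no; exfalso.
  pose x t := odflt 0%R [pick y in petal t | y \in im v].
  have xP t : t \in G :\ t0 -> x t \in petal t /\ x t \in im v.
    rewrite !inE => /andP[tt0 tG]; rewrite /x; case: pickP => [y /andP[]//|no'].
    by have := no t; rewrite tG tt0 /= => /negP[]; apply/pred0P=> y; exact: no'.
  have : #|G :\ t0| <= #|im v|.
    rewrite -(@card_in_imset _ _ x).
      by apply: subset_leq_card; apply/subsetP=> _ /imsetP[t tG ->]; have [] := xP t tG.
    move=> t u tG uG xtu; have [/imsetP[k kK xk] _] := xP t tG.
    have [/imsetP[l _ xl] _] := xP u uG; move: tG uG; rewrite !inE => /andP[_ tG] /andP[_ uG].
    have [kl tu] : k = l /\ t k = u k by apply: petal_inj; rewrite // -xk xtu.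
    apply/eqP; apply: contraT => ntu; have := GK t u tG uG ntu k.
    by rewrite tu eqxx; move: kK; rewrite inE => /negPf ->.
  move=> h1; have := leq_ltn_trans (leq_trans h1 (Bmax vB)) sp.
  by rewrite ltnNge => /negP[]; move: pG; rewrite (cardsD1 t0 G) t0G add1n ltnS.
have tF k : t k \in F by apply: solutionF; exact: (subsetP GZ).
pose Q := [set pos k | k in ~: Ker].
pose kpos j := odflt ord0 [pick k | pos k == j].
have pos_inj : injective pos.
  by move=> k l ekl; apply: (pos_class t0Z); rewrite -(Fe _ _ (tF ord0)) ekl.
have kposK : cancel pos kpos.
  by move=> k; rewrite /kpos; case: pickP => [l /eqP /pos_inj //|/(_ k)]; rewrite eqxx.
pose v' : {ffun 'I_p -> V} := [ffun j => if j \in Q then t (kpos j) j else v j].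
have v'Q k : k \notin Ker -> v' (pos k) = t k (pos k).
  by move=> kK; rewrite ffunE imset_f ?inE // kposK.
have v'N j : j \notin Q -> v' j = v j by move=> /negPf jQ; rewrite ffunE jQ.
have agree k : k \in Ker -> t k = t0 k by move=> kK; apply/eqP; rewrite GK.
have sumQ (f : 'I_p -> V) : (\sum_(j in Q) f j = \sum_(k in ~: Ker) f (pos k))%R.
  by rewrite big_imset //= => k l _ _; exact: pos_inj.
have v'B : v' \in zero_sums p B.
  rewrite mem_zero_sums; apply/andP; split.
    apply/subsetP=> _ /imsetP[j _ ->]; rewrite ffunE; case: ifP => _; first exact: FBw.
    by rewrite ffunE FBw.
  have v0 : (\sum_j v j = 0)%R by move: vB; rewrite mem_zero_sums => /andP[_ /eqP].
  have := Gz t tG; have := Gz t0 t0G; rewrite -!(big_mkcond predT) /=.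
  rewrite (bigID (mem Ker)) [in X in _ -> X -> _](bigID (mem Ker)) /=.
  rewrite (eq_bigr (fun k => t k (pos k))); last by move=> k kK; rewrite agree.
  move=> <- /addrI teq; apply/eqP; apply: etrans v0.
  have splitQ (f : 'I_p -> V) : (\sum_j f j = \sum_(j in Q) f j + \sum_(j | j \notin Q) f j)%R by exact: bigID.
  rewrite (splitQ v') (splitQ v); congr (_ + _)%R; last by apply: eq_bigr => j /v'N.
  rewrite !sumQ; under eq_bigl do rewrite inE; under [RHS]eq_bigl do rewrite inE.
  rewrite (eq_bigr (fun k => t k (pos k))); last by move=> k kK; exact: v'Q.
  by rewrite teq; apply: eq_bigr => k _; rewrite vpos.
have Kpos : 0 < #|~: Ker| by apply/card_gt0P; exists ord0; rewrite inE.
have j1Q : j1 \notin Q.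
  apply/imsetP => -[k _ j1E]; move: pos_j1 e_j1; rewrite j1E => npos /(pos_class t0Z) k0.
  by rewrite k0 eqxx in npos.
pose Q0 := [set v (pos k) | k in ~: Ker :\ ord0].
have sub : petal t :|: (im v :\: Q0) \subset im v'.
  apply/subsetP=> x; rewrite inE => /orP[/imsetP[k kK ->]|].
    by rewrite inE in kK; rewrite -v'Q //; exact: imset_f.
  rewrite inE => /andP[xQ0 /imsetP[j _ xE]]; rewrite {}xE in xQ0 *.
  have [jQ|jQ] := boolP (j \in Q); last by rewrite -v'N //; exact: imset_f.
  case/imsetP: jQ xQ0 => k kK -> xQ0.
  have [->|k0] := eqVneq k ord0; last first.
    by case/imsetP: xQ0; exists k; rewrite // !inE k0 -in_setC.
  have -> : v (pos ord0) = v' j1.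
    rewrite v'N // !ffunE (same_index gF g0 e_j1); apply/eqP.
    by rewrite Fe.
  exact: imset_f.
have petal_card : #|petal t| = #|~: Ker|.
  by rewrite card_in_imset // => k l _ _ /(petal_inj t t k l tG tG)[].
have Q0_card : #|Q0| <= #|~: Ker|.-1.
  apply: leq_trans (leq_imset_card _ _) _.
  by rewrite (cardsD1 ord0 (~: Ker)) inE K0.
have := subset_leq_card sub; rewrite cardsU.
have -> : petal t :&: (im v :\: Q0) = set0.
  apply/eqP; rewrite setI_eq0; apply: disjointWr tv; exact: subsetDl.
have [ims _] := diagonal gF g0; rewrite -/v in ims.
have := Bmax v'B; rewrite cards0 petal_card subn0 cardsD ims => le1 le2.
have := leq_trans (subset_leq_card (subsetIr (im v) Q0)) Q0_card.
have := leq_trans le2 le1; move: Kpos; clear.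
by move: #|~: Ker| #|im v :&: Q0| => m n; lia.
Qed.

Let rest (t : {ffun 'I_K.+1 -> {ffun 'I_p -> V}}) : V :=
  (\sum_(k < K) t (lift ord0 k) (pos (lift ord0 k)))%R.

Let pairs : {set {ffun 'I_p -> V} * V} := [set (t ord0, rest t) | t : {ffun 'I_K.+1 -> {ffun 'I_p -> V}} in solution_tuples].

(** For one value [z] of the total sum, too many pairs would yield a sunflower of more than [p]
    tuples, one chosen by [tau] for each pair. Index 0 is outside its kernel: a common entry there,
    together with the common total, would make the pairs equal. *)
Let card_pairs : #|pairs| <= (K.+1 * p.+1) ^ K.+1 * #|sumset K.+1 B|.
Proof.
pose val (q : {ffun 'I_p -> V} * V) : V := (q.1 (pos ord0) + q.2)%R.
have valE (t : {ffun 'I_K.+1 -> {ffun 'I_p -> V}}) : val (t ord0, rest t) = (\sum_k t k (pos k))%R by rewrite big_ord_recl.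
rewrite (@card_partition_fibres _ _ val _ (sumset K.+1 B)); last first.
  move=> _ /imsetP[t tZ ->]; rewrite valE; apply/imsetP; exists [ffun k => t k (pos k)].
    by apply/ffun_onP=> k; rewrite ffunE; apply: FBw; exact: solutionF.
  by apply: eq_bigr => k _; rewrite ffunE.
rewrite mulnC -sum_nat_const; apply: leq_sum => z _.
set Fz := [set q in pairs | _].
pose t0 : {ffun 'I_K.+1 -> {ffun 'I_p -> V}} := [ffun=> [ffun=> 0%R]].
pose tau q := odflt t0 [pick t : {ffun 'I_K.+1 -> {ffun 'I_p -> V}} in solution_tuples | (t ord0, rest t) == q].
have tauP q : q \in pairs -> tau q \in solution_tuples /\ (tau q ord0, rest (tau q)) = q.
  case/imsetP=> t tZ qE; rewrite /tau; case: pickP => [u /andP[uZ /eqP uq]|/(_ t)] //=.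
  by rewrite tZ qE eqxx.
have FzP q : q \in Fz -> q \in pairs /\ val q = z by rewrite inE => /andP[qP /eqP].
rewrite leqNgt; apply/negP => ltF.
have tau_inj : {in Fz &, injective tau}.
  move=> q q' /FzP[/tauP[_ e1] _] /FzP[/tauP[_ e2] _] eqt.
  by rewrite -e1 -e2 eqt.
rewrite -(card_in_imset tau_inj) in ltF.
have [//|G [Ker [GF pG GK]]] := sunflower _ ltF.
have GP t : t \in G -> exists2 q, q \in Fz & t = tau q.
  by move=> /(subsetP GF)/imsetP.
have GZ : G \subset solution_tuples.
  by apply/subsetP=> t /GP[q /FzP[/tauP[qZ _] _] ->].
have Gz t : t \in G -> (\sum_k t k (pos k) = z)%R.
  by move=> /GP[q /FzP[/tauP[_ qE] qz] ->]; rewrite -valE qE.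
apply: (no_sunflower GZ pG _ Gz GK); apply/negP => K0.
have /card_gt1P[t [u [tG uG tu]]] : 1 < #|G| by apply: leq_trans pG; exact: leq_ltn_trans (leq0n s) sp.
have t0u0 : t ord0 = u ord0 by apply/eqP; rewrite GK.
have rtu : rest t = rest u.
  have := valE t; rewrite (Gz t tG) -(Gz u uG) -valE /val /= t0u0.
  by move/addrI.
move/negP: tu; apply; apply/eqP.
have [q qF tq] := GP t tG; have [q' q'F uq] := GP u uG.
have [[/tauP[_ e1] _] [/tauP[_ e2] _]] := (FzP _ qF, FzP _ q'F).
by rewrite tq uq -e1 -e2 -tq -uq t0u0 rtu.
Qed.

(** The first entry is fixed to a favourable [b]. The sums of the remaining [K] entries are then
    second components of pairs starting with [b], of which there are on average
    [#|pairs| / #|F|]. *)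
Lemma exists_dense_tuple_set : solution_tuples != set0 ->
  exists W : {set {ffun 'I_K -> V}}, [/\ forall u k, u \in W -> u k \in B,
    #|solution_tuples| <= 4 * #|F| * #|W| &
    #|solution_tuples| * #|[set (\sum_k u k)%R | u : {ffun 'I_K -> V} in W]| <=
      2 * ((K.+1 * p.+1) ^ K.+1 * #|sumset K.+1 B|) * #|W|].
Proof.
move=> Zn0; set Z := solution_tuples in Zn0 *.
have Z0 : 0 < #|Z| by rewrite card_gt0.
have [t0 t0Z] := set0Pn _ Zn0.
pose Zb b := [set t : {ffun 'I_K.+1 -> {ffun 'I_p -> V}} in Z | t ord0 == b].
pose Qb b := [set q in pairs | q.1 == b].
have ZE : #|Z| = \sum_(b in F) #|Zb b|.
  by apply: card_partition_fibres => t tZ; exact: solutionF.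
have QE : #|pairs| = \sum_(b in F) #|Qb b|.
  by apply: card_partition_fibres => q /imsetP[t tZ ->] /=; exact: solutionF.
have F0 : 0 < #|F| by apply/card_gt0P; exists (t0 ord0); exact: solutionF.
have Q0 : 0 < #|pairs| by apply/card_gt0P; exists (t0 ord0, rest t0); exact: imset_f.
(* One averaging secures both bounds: dropping either summand on the left gives [le1] or [le2].
   Summed over [F], the left side is 3 and the right side 4 times [#|F| * #|Z| * #|pairs|]. *)
have [b bF bP] : exists2 b, b \in F &
    #|Z| * #|pairs| + 2 * #|F| * #|Z| * #|Qb b| <= 4 * #|F| * #|pairs| * #|Zb b|.
  apply/exists_inP; apply: contraT; rewrite negb_exists_in => /forall_inP no.
  have : \sum_(b in F) (4 * #|F| * #|pairs| * #|Zb b|).+1 <=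
         \sum_(b in F) (#|Z| * #|pairs| + 2 * #|F| * #|Z| * #|Qb b|).
    by apply: leq_sum => b bF; have := no b bF; rewrite -ltnNge.
  rewrite big_split /= sum_nat_const -big_distrr /= -QE.
  under eq_bigr do rewrite -addn1; rewrite big_split /= -big_distrr /= -ZE sum1_card.
  rewrite (_ : 4 * #|F| * #|pairs| * #|Z| = 4 * (#|F| * (#|Z| * #|pairs|))); last by ring.
  rewrite (_ : 2 * #|F| * #|Z| * #|pairs| = 2 * (#|F| * (#|Z| * #|pairs|))); last by ring.
  set m := #|F| * _ => le_m; move: F0; rewrite ltnNge => /negP[].
  rewrite -(leq_add2l (4 * m)); apply: leq_trans le_m _.
  by rewrite addn0 -mulSn leq_mul2r orbT.
have le1 : #|Z| <= 4 * #|F| * #|Zb b|.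
  rewrite -(@leq_pmul2r #|pairs|) //; apply: leq_trans (leq_trans (leq_addr _ _) bP) _.
  by apply: eq_leq; ring.
have le2 : #|Z| * #|Qb b| <= 2 * #|pairs| * #|Zb b|.
  rewrite -(@leq_pmul2l (2 * #|F|)) ?muln_gt0 //.
  rewrite mulnA; apply: leq_trans (leq_trans (leq_addl _ _) bP) _.
  by apply: eq_leq; ring.
pose f (t : {ffun 'I_K.+1 -> {ffun 'I_p -> V}}) : {ffun 'I_K -> V} :=
  [ffun k => t (lift ord0 k) (pos (lift ord0 k))].
have f_inj : {in Zb b &, injective f}.
  move=> t u /setIdP[tZ /eqP tb] /setIdP[uZ /eqP ub] /ffunP ftu.
  apply/ffunP=> k; case: (unliftP ord0 k) => [l ->|->]; last by rewrite tb ub.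
  have := ftu l; rewrite !ffunE => /(F_inj (solutionF _ tZ) (solutionF _ uZ)) [].
  by [].
exists (f @: Zb b); split.
- move=> _ k /imsetP[t + ->]; rewrite inE => /andP[tZ _].
  by rewrite ffunE; apply: FBw; exact: solutionF.
- by rewrite (card_in_imset f_inj).
rewrite (card_in_imset f_inj).
apply: (@leq_trans (#|Z| * #|Qb b|)).
  rewrite leq_mul2l; apply/orP; right.
  have : [set (\sum_k u k)%R | u : {ffun 'I_K -> V} in f @: Zb b] \subset [set q.2 | q in Qb b].
    apply/subsetP=> _ /imsetP[_ /imsetP[t + ->] ->]; rewrite inE => /andP[tZ tb].
    apply/imsetP; exists (t ord0, rest t); first by rewrite inE tb andbT; exact: imset_f.
    by apply: eq_bigr => k _; rewrite ffunE.
  by move=> /subset_leq_card/leq_trans; apply; exact: leq_imset_card.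
apply: leq_trans le2 _; rewrite leq_mul2r; apply/orP; right.
by rewrite leq_mul2l card_pairs orbT.
Qed.
End Stuck.

(** * Supersaturation *)

Lemma exists_injective_positions (I J : finType) (g : I -> J) (i0 : I) K :
  K < #|[set g i | i in I]| ->
  exists pos : {ffun 'I_K.+1 -> I}, pos ord0 = i0 /\ injective (fun k => g (pos k)).
Proof.
move=> ltK; pose s := g i0 :: enum ([set g i | i in I] :\ g i0).
have s_uniq : uniq s by rewrite /= enum_uniq mem_enum !inE eqxx.
have s_size : K < size s.
  by rewrite /= -cardE; move: ltK; rewrite (cardsD1 (g i0)) imset_f.
pose pos : {ffun 'I_K.+1 -> I} := [ffun k : 'I_K.+1 =>
  if k == ord0 then i0 else odflt i0 [pick i | g i == nth (g i0) s k]].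
have gpos k : g (pos k) = nth (g i0) s k.
  rewrite ffunE; case: eqP => [->//|_].
  case: pickP => [i /eqP //|no].
  have : nth (g i0) s k \in s by apply/mem_nth/(leq_trans (ltn_ord k)).
  rewrite inE => /orP[/eqP ->//|]; rewrite mem_enum !inE => /andP[_ /imsetP[i _ e]].
  by have := no i; rewrite e eqxx.
exists pos; split; first by rewrite ffunE eqxx.
move=> k l; rewrite !gpos => /eqP; rewrite nth_uniq //; first by move=> /eqP /val_inj.
  exact: leq_trans (ltn_ord k) s_size.
exact: leq_trans (ltn_ord l) s_size.
Qed.

Lemma expn_le_ffact M N : 2 * N ^ 2 <= M -> M ^ N <= 2 * M ^_ N.
Proof.
move=> le_M.
have [M0|M0] := posnP M; first by move: le_M; rewrite M0; case: (N) => // m; rewrite leqn0 muln_eq0 expn_eq0.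
(* The product of the [1 - i / M] for [i < n] is at least [1 - n ^ 2 / M], cleared of
   denominators. *)
have H n : n <= N -> (M - n * n) * M ^ n <= M ^_ n * M.
  elim: n => [|n IHn] le_n; first by rewrite mul0n subn0 expn0 ffactn0 muln1 mul1n.
  have := IHn (ltnW le_n); rewrite ffactnSr expnS => le1.
  have nM : n.+1 * n.+1 <= M by rewrite -mulnn in le_M; nia.
  apply: (@leq_trans ((M - n) * ((M - n * n) * M ^ n))); last first.
    have := leq_mul (leqnn (M - n)) le1; move: (M - n) (M - n * n) => a b.
    by congr (_ <= _); ring.
  rewrite !mulnA leq_mul2r; apply/orP; right.
  have [k Mk] : exists k, M = n.+1 * n.+1 + k by exists (M - n.+1 * n.+1); rewrite subnKC.
  have -> : M - n.+1 * n.+1 = k by rewrite Mk addKn.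
  have -> : M - n = n * n + n + 1 + k by rewrite Mk mulSn mulnS; clear; lia.
  have -> : M - n * n = 2 * n + 1 + k by rewrite Mk mulSn mulnS; clear; lia.
  rewrite Mk (_ : _ * (2 * n + 1 + k) = k * (n.+1 * n.+1 + k) + (k * n + k + (n * n + n + 1) * (2 * n + 1))).
    exact: leq_addr.
  by ring.
rewrite -(@leq_pmul2r M) //; apply: leq_trans (_ : 2 * ((M - N * N) * M ^ N) <= _).
  rewrite mulnC mulnA leq_mul2r; apply/orP; right; rewrite -mulnn in le_M; lia.
by rewrite -mulnA leq_mul2l H.
Qed.

(** For a uniformly random [f], its restriction along the injective [tau] is uniform. The injection
    [h] swaps the values of [f] on the range of [tau] with an independent tuple. *)
Lemma card_extensions (I J T : finType) (F : {set T}) (Z : {set {ffun J -> T}}) (tau : J -> I) :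
  injective tau ->
  #|[set f : {ffun I -> T} in ffun_on (mem F) | [ffun k => f (tau k)] \in Z]| * #|F| ^ #|J| <=
    #|Z| * #|F| ^ #|I|.
Proof.
move=> tau_inj; rewrite -(card_ffun_on J) -(card_ffun_on I).
set S := [set f | _].
pose rho i := [pick k | tau k == i].
have rhoK k : rho (tau k) = Some k.
  by rewrite /rho; case: pickP => [l /eqP /tau_inj ->//|/(_ k)]; rewrite eqxx.
have rhoN i : rho i = None -> forall k, tau k != i.
  by rewrite /rho; case: pickP => // no _ k; rewrite no.
have rhoS i k : rho i = Some k -> i = tau k.
  by rewrite /rho; case: pickP => [l /eqP <- [->]|//].
pose h (q : {ffun I -> T} * {ffun J -> T}) : {ffun J -> T} * {ffun I -> T} :=
  ([ffun k => q.1 (tau k)], [ffun i => if rho i is Some k then q.2 k else q.1 i]).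
have h_inj : injective h.
  move=> [f u] [f' u'] [/ffunP e1 /ffunP e2].
  have fe k : f (tau k) = f' (tau k) by have := e1 k; rewrite !ffunE.
  congr (_, _); apply/ffunP; last by move=> k; have := e2 (tau k); rewrite !ffunE rhoK.
  move=> i; case ri : (rho i) => [k|]; first by rewrite (rhoS _ _ ri) fe.
  by have := e2 i; rewrite !ffunE ri.
have cardD (A B : finType) (P : {pred A}) (Q : {pred B}) : #|P| * #|Q| = #|setX [set x in P] [set y in Q]|.
  by rewrite cardsX !cardsE.
rewrite (cardD _ _ (mem S)) (cardD _ _ (mem Z)) -(card_imset _ h_inj); apply: subset_leq_card.
apply/subsetP=> _ /imsetP[[f u] + ->]; rewrite !inE /= => /andP[/andP[/ffun_onP fF fZ] /ffun_onP uF].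
rewrite fZ; apply/ffun_onP=> i; rewrite ffunE; case: (rho i) => [k|]; [exact: uF | exact: fF].
Qed.

(** Every choice of [N] distinct tuples from [F] contains a solution tuple, located by one of at
    most [(p * N) ^ K.+1] pairs ([pos], [tau]). Distinct choices are at least half of all choices,
    so some [pos] has many solutions. *)
Lemma exists_many_solution_tuples (p n n' K N : nat) (B : {set 'rV['F_p]_n})
    (F : {set {ffun 'I_p -> 'rV['F_p]_n}}) (j0 : 'I_p) :
  prime p -> 0 < K -> N ^ K * K ^ p < p ^ n' -> p * 4 ^ (n + n') < N -> 2 * N ^ 2 <= #|F| ->
  F \subset zero_sums p B ->
  exists pos : {ffun 'I_K.+1 -> 'I_p}, pos ord0 = j0 /\
    #|F| ^ K.+1 <= 2 * (p * N) ^ K.+1 * #|solution_tuples F pos|.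
Proof.
move=> p_prime K0 ltN lt4 leNF FB.
have N0 : 0 < N by apply: leq_ltn_trans lt4.
have F0 : 0 < #|F| by apply: leq_trans leNF; rewrite muln_gt0 expn_gt0 N0.
pose W := {ffun 'I_p -> 'rV['F_p]_n}.
pose Fin := [set f : {ffun 'I_N -> W} in ffun_on (mem F) | injectiveb f].
have cardFin : #|Fin| = #|F| ^_ N.
  by rewrite /Fin card_inj_ffuns_on card_ord.
pose Zf (pos : {ffun 'I_K.+1 -> 'I_p}) (tau : {ffun 'I_K.+1 -> 'I_N}) :=
  [set f : {ffun 'I_N -> W} in ffun_on (mem F) | [ffun k => f (tau k)] \in solution_tuples F pos].
have cover f : f \in Fin -> exists (pos : {ffun 'I_K.+1 -> 'I_p}) (tau : {ffun 'I_K.+1 -> 'I_N}), [/\ pos ord0 = j0, injective tau & f \in Zf pos tau].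
  case/setIdP=> /ffun_onP fF /injectiveP f_inj.
  have [||q|g [g0 gK]] := @zero_sum_many_indices p n n' K 'I_N (fun j q => f q j) p_prime K0.
  - by rewrite card_ord.
  - by rewrite card_ord.
  - by have := subsetP FB _ (fF q); rewrite mem_zero_sums => /andP[_ /eqP].
  have [pos [pos0 pos_inj]] := exists_injective_positions j0 gK.
  exists pos, [ffun k => g (pos k)]; split=> //.
    by move=> k l; rewrite !ffunE; exact: pos_inj.
  apply/setIdP; split; first exact/ffun_onP.
  rewrite inE; apply/andP; split.
    by apply/injectiveP=> k l; rewrite !ffunE => /f_inj; exact: pos_inj.
  apply/existsP; exists [ffun j => f (g j)]; apply/and3P; split.
  - by apply/forallP=> j; rewrite ffunE; exact: fF.
  - by under eq_bigr do rewrite ffunE; apply/eqP.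
  - by apply/forallP=> k; rewrite !ffunE.
have [/existsP[pos /andP[/eqP pos0 posP]]|] := boolP [exists pos : {ffun 'I_K.+1 -> 'I_p},
    (pos ord0 == j0) && (#|F| ^ K.+1 <= 2 * (p * N) ^ K.+1 * #|solution_tuples F pos|)].
  by exists pos.
rewrite negb_exists => /forallP no; exfalso.
have small (pos : {ffun 'I_K.+1 -> 'I_p}) : pos ord0 = j0 -> 2 * (p * N) ^ K.+1 * #|solution_tuples F pos| < #|F| ^ K.+1.
  by move=> pos0; have := no pos; rewrite pos0 eqxx /= -ltnNge.
pose P (u : {ffun 'I_K.+1 -> 'I_p} * {ffun 'I_K.+1 -> 'I_N}) := (u.1 ord0 == j0) && injectiveb u.2.
have sub : Fin \subset \bigcup_(u | P u) Zf u.1 u.2.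
  apply/subsetP=> f /cover[pos [tau [pos0 tau_inj fZ]]].
  by apply/bigcupP; exists (pos, tau) => //; rewrite /P /= pos0 eqxx; exact/injectiveP.
have cardP : #|P| <= (p * N) ^ K.+1.
  by apply: leq_trans (max_card _) _; rewrite card_prod !card_ffun !card_ord expnMn.
have F0K : 0 < #|F| ^ K.+1 by rewrite expn_gt0 F0.
have bound u : P u -> 2 * (p * N) ^ K.+1 * #|Zf u.1 u.2| < #|F| ^ N.
  case/andP=> /eqP /small lt1 /injectiveP tau_inj.
  rewrite -(@ltn_pmul2r (#|F| ^ K.+1)) //.
  have := card_extensions F (solution_tuples F u.1) tau_inj; rewrite !card_ord.
  have c0 : 0 < 2 * (p * N) ^ K.+1 by rewrite muln_gt0 expn_gt0 muln_gt0 (prime_gt0 p_prime) N0.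
  rewrite -(leq_pmul2l c0).
  rewrite !mulnA => /leq_ltn_trans; apply.
  by rewrite mulnC ltn_pmul2l ?expn_gt0 ?F0.
have : #|Fin| * (2 * (p * N) ^ K.+1) < (p * N) ^ K.+1 * #|F| ^ N.
  have [f fFin] : exists f, f \in Fin.
    apply/card_gt0P; rewrite cardFin; have := expn_le_ffact leNF.
    by case: (_ ^_ _) => //; rewrite muln0 leqn0 expn_eq0 (gtn_eqF F0).
  have /bigcupP[u0 Pu0 _] := subsetP sub f fFin.
  apply: leq_ltn_trans (_ : \sum_(u | P u) #|Zf u.1 u.2| * (2 * (p * N) ^ K.+1) < _).
    by rewrite -big_distrl leq_mul2r (leq_trans (subset_leq_card sub) (card_bigcup_le _ _)) orbT.
  apply: (@leq_trans (\sum_(u | P u) #|F| ^ N)); last first.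
    by rewrite sum_nat_const leq_mul2r cardP orbT.
  rewrite (bigD1 u0) //= [X in _ < X](bigD1 u0) //= -addSn; apply: leq_add.
    by rewrite mulnC bound.
  by apply: leq_sum => u /andP[Pu _]; rewrite mulnC ltnW ?bound.
rewrite ltnNge => /negP[]; apply: leq_trans (leq_mul (leqnn _) (expn_le_ffact leNF)) _.
by rewrite cardFin; apply: eq_leq; ring.
Qed.

(** * The induction on the growth exponent *)

Fixpoint tup_of (V : finZmodType) r (x : nat -> V) : tup V r :=
  if r is r'.+1 return tup V r then (tup_of r' x, tup_of r' (fun k => x (2 ^ r' + k))) else x 0.

Lemma tup_in_of (V : finZmodType) (A : {set V}) r (x : nat -> V) :
  (forall k, k < 2 ^ r -> x k \in A) -> tup_of r x \in tup_in A r.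
Proof.
elim: r x => [|r IHr] x xA /=; first exact: xA.
by rewrite inE /= !IHr // => k kr; apply: xA; rewrite expnS; lia.
Qed.

Lemma tup_sum_of (V : finZmodType) r (x : nat -> V) :
  tup_sum (tup_of r x) = (\sum_(k < 2 ^ r) x k)%R.
Proof.
elim: r x => [|r IHr] x /=; first by rewrite big_ord1.
by rewrite !IHr expnS mul2n -addnn big_split_ord.
Qed.

Lemma tup_of_inj (V : finZmodType) r (x y : nat -> V) :
  tup_of r x = tup_of r y -> forall k, k < 2 ^ r -> x k = y k.
Proof.
elim: r x y => [|r IHr] x y /=; first by move=> xy0 [].
move=> [/IHr e1 /IHr e2] k; rewrite expnS => kr.
have [lt_k|ge_k] := ltnP k (2 ^ r); first exact: e1.
by rewrite -(subnKC ge_k); apply: e2; lia.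
Qed.

Lemma tuples_to_tup (V : finZmodType) (A : {set V}) r (W : {set {ffun 'I_(2 ^ r) -> V}}) :
  (forall u k, u \in W -> u k \in A) ->
  exists W' : {set tup V r}, [/\ W' \subset tup_in A r, #|W'| = #|W| &
    [set tup_sum u | u in W'] = [set (\sum_k u k)%R | u : {ffun 'I_(2 ^ r) -> V} in W]].
Proof.
move=> WA; pose ext (u : {ffun 'I_(2 ^ r) -> V}) k := oapp u 0%R (insub k).
have extE u (k : 'I_(2 ^ r)) : ext u k = u k by rewrite /ext valK.
exists [set tup_of r (ext u) | u in W]; split.
- apply/subsetP=> _ /imsetP[u uW ->]; apply: tup_in_of => k kr.
  by rewrite -[k]/(nat_of_ord (Ordinal kr)) extE WA.
- apply: card_imset => u v /tup_of_inj uv; apply/ffunP=> k.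
  by rewrite -!extE; apply: uv.
apply/setP=> z; apply/imsetP/imsetP => [[_ /imsetP[u uW ->] ->]|[u uW ->]].
  by exists u => //; rewrite tup_sum_of; apply: eq_bigr => k _; rewrite extE.
exists (tup_of r (ext u)); first exact: imset_f.
by rewrite tup_sum_of; apply: eq_bigr => k _; rewrite extE.
Qed.

Definition has_distinct_zero_sum p n (A : {set 'rV['F_p]_n}) :=
  exists x : 'I_p -> 'rV['F_p]_n,
    injective x /\ (forall i : 'I_p, x i \in A) /\ (\sum_(i < p) x i = 0)%R.

Definition pattern_cost p := 2 * (2 * p) ^ p * 2 ^ (p * p).

(** The losses in order: the two averagings ([2 * 4]), the sunflower bound, the location of
    solutions, and the passage from [A] to [F] in each of the [K.+1] entries. *)
Definition tuple_cost p K N :=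
  8 * (K.+1 * p.+1) ^ K.+1 * (p * N) ^ K.+1 * pattern_cost p ^ K.+1.

Lemma exists_dense_tuples (p n n' K N : nat) (A : {set 'rV['F_p]_n}) :
  prime p -> 0 < K -> N ^ K * K ^ p < p ^ n' -> p * 4 ^ (n + n') < N ->
  tuple_cost p K N <= #|A| -> ~ has_distinct_zero_sum A ->
  exists W : {set {ffun 'I_K -> 'rV['F_p]_n}}, [/\ forall u k, u \in W -> u k \in A,
    #|A| ^ K <= tuple_cost p K N * #|W| &
    #|A| * #|[set (\sum_k u k)%R | u : {ffun 'I_K -> 'rV['F_p]_n} in W]| <=
      tuple_cost p K N * #|sumset K.+1 A|].
Proof.
move=> p_prime K0 ltN lt4; rewrite /tuple_cost; set c := pattern_cost p; set R := (_ ^ _).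
set L := (p * N) ^ K.+1 => leA noA.
have p0 := prime_gt0 p_prime.
have N0 : 0 < N by apply: leq_ltn_trans lt4.
have c0 : 0 < c by rewrite !muln_gt0 !expn_gt0 muln_gt0 p0.
have R0 : 0 < R by rewrite expn_gt0.
have L0 : 0 < L by rewrite expn_gt0 muln_gt0 p0 N0.
have A0 : 0 < #|A| by apply: leq_trans leA; rewrite !muln_gt0 expn_gt0 c0 R0 L0.
have [|||s [B [F [e [[sp BA FB leF Fdis] [Fs Fe Bmax]]]]]] := @stuck_system p _ A p0.
- by rewrite -card_gt0.
- move=> x _; apply/rowP=> i; rewrite mulmxnE mxE -mulr_natr.
  by rewrite (pcharf0 (pchar_Fp p_prime)) mulr0.
- move=> w; rewrite mem_zero_sums => /andP[/subsetP wA /eqP w0]; rewrite ltn_neqAle card_im_le andbT.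
  apply/eqP=> cim; apply: noA; exists w; split=> //; last first.
    by split=> // i; apply: wA; exact: imset_f.
  have /imset_injP inj : #|im w| == #|'I_p| by rewrite cim card_ord.
  by move=> i j; apply: inj.
have F0 : 0 < #|F| by rewrite lt0n; apply: contraTneq leF => ->; rewrite muln0 -ltnNge.
have leF' : #|A| <= c * #|F| by [].
have leNF : 2 * N ^ 2 <= #|F|.
  rewrite -(@leq_pmul2l c) //; apply: leq_trans leF'; apply: leq_trans leA.
  have h1 : c <= c ^ K.+1 by rewrite -{1}(expn1 c) leq_pexp2l.
  have h2 : N ^ 2 <= L.
    apply: (@leq_trans (N ^ K.+1)); first by rewrite leq_pexp2l.
    by rewrite leq_exp2r // leq_pmull.
  apply: (@leq_trans (2 * (L * c ^ K.+1))).
    by rewrite mulnCA leq_mul2l mulnC leq_mul.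
  by rewrite -!mulnA; apply: leq_mul => //; exact: leq_pmull.
have /card_gt0P[w wF] := F0.
have [j0 [j1 [j01 ej]]] : exists j0 j1, j0 != j1 /\ e (j0, j1).
  have /injectivePn[j0 [j1 j01 wj]] : ~~ injectiveb w.
    apply/negP => /injectiveP w_inj; have := sp.
    by rewrite -(Fs w wF) /im card_imset // card_ord ltnn.
  by exists j0, j1; split=> //; rewrite -(Fe w) // wj.
have [pos [pos0 leZ]] := exists_many_solution_tuples j0 p_prime K0 ltN lt4 leNF FB.
set Z := solution_tuples F pos in leZ.
have Zn0 : Z != set0.
  rewrite -card_gt0 lt0n; apply: contraTneq leZ => ->.
  by rewrite muln0 -ltnNge expn_gt0 F0.
have [||W [WB leW leS]] := @exists_dense_tuple_set p _ s B F e sp FB Fdis Fs Fe Bmax K pos j1 _ _ Zn0.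
- by rewrite pos0.
- by rewrite pos0.
have leFZ : #|A| ^ K.+1 <= c ^ K.+1 * (2 * L * #|Z|).
  apply: leq_trans (leq_mul (leqnn _) leZ); rewrite -expnMn leq_exp2r //.
have WA : #|W| <= #|A| ^ K.
  have := card_ffun_on 'I_K (mem A); rewrite card_ord => <-; apply: subset_leq_card; apply/subsetP=> u uW; apply/ffun_onP=> k.
  exact: (subsetP BA) (WB u k uW).
have SBA : #|sumset K.+1 B| <= #|sumset K.+1 A|.
  apply: subset_leq_card; apply: imsetS; apply/subsetP=> u /ffun_onP uB; apply/ffun_onP=> k.
  exact: (subsetP BA).
exists W; split=> [u k uW||]; first exact: (subsetP BA) (WB u k uW).
- rewrite -(@leq_pmul2l #|F|) //.
  apply: (@leq_trans (c ^ K * (2 * L * (4 * #|F| * #|W|)))).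
    apply: (@leq_trans (c ^ K * #|F| ^ K.+1)).
      rewrite [X in _ <= _ * X]expnS mulnCA leq_mul2l -expnMn; apply/orP; right.
      by rewrite leq_exp2r.
    by rewrite leq_mul2l (leq_trans leZ) ?orbT // leq_mul2l leW orbT.
  have -> : c ^ K * (2 * L * (4 * #|F| * #|W|)) = 8 * L * c ^ K * #|F| * #|W| by ring.
  have -> : #|F| * (8 * R * L * c ^ K.+1 * #|W|) = 8 * L * c ^ K * #|F| * #|W| * (R * c).
    by rewrite expnS; ring.
  by rewrite leq_pmulr // muln_gt0 R0.
set S := #|[set _ | _ in W]| in leS *; set T := #|sumset _ A| in SBA *.
have AK0 : 0 < #|A| ^ K by rewrite expn_gt0 A0.
rewrite -(@leq_pmul2l (#|A| ^ K)) //.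
apply: (@leq_trans (c ^ K.+1 * (2 * L * #|Z|) * S)).
  by rewrite mulnA -expnSr leq_mul2r leFZ orbT.
apply: (@leq_trans (c ^ K.+1 * (2 * L) * (2 * (R * T) * #|A| ^ K))).
  rewrite (_ : c ^ K.+1 * (2 * L * #|Z|) * S = c ^ K.+1 * (2 * L) * (#|Z| * S)); last by ring.
  rewrite leq_mul2l; apply/orP; right.
  by apply: leq_trans leS _; apply: leq_mul => //; rewrite leq_mul2l leq_mul2l SBA !orbT.
have -> : c ^ K.+1 * (2 * L) * (2 * (R * T) * #|A| ^ K) = 4 * (c ^ K.+1 * L * R * T * #|A| ^ K) by ring.
have -> : #|A| ^ K * (8 * R * L * c ^ K.+1 * T) = 8 * (c ^ K.+1 * L * R * T * #|A| ^ K) by ring.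
by rewrite leq_mul2r orbT.
Qed.

(** As [n + n' <= 3 * (n + nu)], the power of 4 in [N ^ K] is at most [(64 ^ K) ^ (n + nu)], hence
    at most [p ^ (n + nu)], half of the exponent [n']. The other half exceeds [p ^ (2 * K) * p ^ p],
    by the choice of [nu]. In the second bound only [64 ^ n] depends on [n], and its base is free of
    [p]. *)
Lemma parameter_bounds p K n : 1 < p -> 0 < K -> 64 ^ K <= p ->
  let nu := 2 * K + p + 1 in let n' := 2 * (n + nu) in let N := p * 4 ^ (n + n') + 1 in
  N ^ K * K ^ p < p ^ n' /\ N <= 2 * p * 16 ^ nu * 64 ^ n.
Proof.
move=> p1 K0 Kp nu n' N.
have le_N : N <= 2 * p * 4 ^ (n + n').
  by rewrite /N -mulnA mul2n -addnn leq_add2l muln_gt0 expn_gt0 (ltnW p1).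
split; last first.
  apply: leq_trans le_N _; rewrite -!mulnA leq_mul2l leq_mul2l; apply/orP; right; apply/orP; right.
  have -> : n + n' = 2 * nu + 3 * n by rewrite /n'; ring.
  by rewrite expnD !expnM.
have Klep : K <= p by apply: leq_trans Kp; exact/ltnW/ltn_expl.
have le1 : N ^ K <= p ^ (2 * K) * p ^ (n + nu).
  apply: (@leq_trans ((2 * p * 4 ^ (n + n')) ^ K)); first by rewrite leq_exp2r.
  rewrite expnMn; apply: leq_mul.
    by rewrite expnM leq_exp2r // -mulnn leq_mul2r p1 orbT.
  apply: (@leq_trans ((64 ^ (n + nu)) ^ K)).
    rewrite leq_exp2r // -[64]/(4 ^ 3) -expnM leq_exp2l // /n'; lia.
  have nu0 : 0 < n + nu by rewrite /nu addn1 addnS.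
  by rewrite -expnM mulnC expnM leq_exp2r.
apply: (@leq_ltn_trans (p ^ (2 * K) * p ^ (n + nu) * p ^ p)).
  by apply: leq_mul le1 _; rewrite leq_exp2r // ltnW.
by rewrite -!expnD ltn_exp2l // /n' /nu; lia.
Qed.

Definition small_growth_suffices (d : nat) := exists l C p0 : nat,
  [/\ 0 < l, 0 < C & forall p, prime p -> p0 <= p -> exists2 D, 0 < D &
  forall n (A : {set 'rV['F_p]_n}), D * C ^ n <= #|A| -> #|sumset l A| ^ 2 <= #|A| ^ d ->
  has_distinct_zero_sum A].

Lemma small_growth_base : small_growth_suffices 1.
Proof.
exists 1, 1, 0; split=> // p p_prime _; exists 2 => // n A; rewrite exp1n muln1 expn1 => A2.
rewrite sumsetS sumset0 card_addset1 -mulnn.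
by rewrite leqNgt ltn_Pmulr // (leq_trans _ A2).
Qed.

Lemma tuple_cost_gt0 p K N : 0 < p -> 0 < N -> 0 < tuple_cost p K N.
Proof.
by move=> p0 N0; rewrite /tuple_cost /pattern_cost !(muln_gt0, expn_gt0) p0 N0.
Qed.

Lemma small_growth_step d : 0 < d -> small_growth_suffices d -> small_growth_suffices d.+1.
Proof.
move=> d0 [l [C [p0 [l0 C0 IH]]]].
(* [e] makes the factor [#|A| ^ (2 * l)] cost an exponent 1/4 of [#|A|], and [E] makes the passage
   from [A] to [A'] cost 1/8 in [#|A| ^ (d / 2)]. The sums [S] satisfy
   [S ^ e <= #|A| ^ (4 * l * d)], which [r] exceeds. *)
pose e := 8 * l; pose E := 4 * d; pose r := d * e + 1; pose K := 2 ^ r.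
have e0 : 0 < e by rewrite muln_gt0.
have E0 : 0 < E by rewrite muln_gt0.
have K0 : 0 < K by rewrite expn_gt0.
have [M [a0 [M0 BC]]] := @exists_small_sumset e l r E e0 E0.
pose m := 8 * M; have m0 : 0 < m by rewrite muln_gt0.
(* The power of 64 absorbs [T ^ m], where [T] grows like [64 ^ (n * K.+1)]; the factor [C ^ E] keeps
   [A'] above [D * C ^ n]. *)
exists K.+1, (64 ^ (K.+1 * m) * C ^ E), (maxn p0 (64 ^ K)).
split; [by [] | by rewrite muln_gt0 !expn_gt0 C0 | move=> p p_prime].
rewrite geq_max => /andP[p0p Kp]; have [D D0 DP] := IH p p_prime p0p.
have p1 := prime_gt1 p_prime.
pose nu := 2 * K + p + 1; pose kappa := 2 * p * 16 ^ nu.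
have kappa0 : 0 < kappa by rewrite !muln_gt0 expn_gt0 (ltnW p1).
pose Q := tuple_cost p K kappa; have Q0 : 0 < Q by apply: tuple_cost_gt0; rewrite // ltnW.
exists (Q ^ m * D ^ E * (a0 + 2)) => [|n A leA leG].
  by rewrite !muln_gt0 !expn_gt0 Q0 D0 addn2.
have [/exists_inP[w + /injectiveP w_inj]|noA] := boolP [exists w in zero_sums p A, injectiveb w].
  rewrite mem_zero_sums => /andP[/subsetP wA /eqP w0]; exists w; split=> //.
  by split=> // i; apply: wA; exact: imset_f.
have {}noA : ~ has_distinct_zero_sum A.
  case=> x [x_inj [xA x0]]; move/exists_inP: noA; apply; exists [ffun i => x i].
    rewrite inE; apply/andP; split; first by apply/ffun_onP=> i; rewrite ffunE.
    by under eq_bigr do rewrite ffunE; apply/eqP.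
  by apply/injectiveP=> i j; rewrite !ffunE; exact: x_inj.
pose n' := 2 * (n + nu); pose N := p * 4 ^ (n + n') + 1.
have [ltN leN] := @parameter_bounds p K n p1 K0 Kp.
rewrite -/nu -/n' -/N -/kappa in ltN leN.
pose T := tuple_cost p K N.
have T0 : 0 < T by apply: tuple_cost_gt0; rewrite ?(ltnW p1) // /N addn1.
have leT : T <= Q * 64 ^ (n * K.+1).
  rewrite /T /Q /tuple_cost; move: (_ ^ K.+1) (pattern_cost p ^ K.+1) => R1 R2.
  rewrite -[X in _ <= X]mulnA [R2 * _]mulnC mulnA leq_mul2r -!mulnA !leq_mul2l.
  apply/orP; right; apply/orP; right; apply/orP; right.
  by rewrite expnM -expnMn leq_exp2r // -mulnA leq_mul2l leN orbT.
have ltA : T ^ m * (D * C ^ n) ^ E * (a0 + 2) <= #|A|.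
  apply: leq_trans leA.
  have -> : (64 ^ (K.+1 * m) * C ^ E) ^ n = 64 ^ (K.+1 * m * n) * C ^ (E * n) by rewrite expnMn -!expnM.
  have -> : (D * C ^ n) ^ E = D ^ E * C ^ (n * E) by rewrite expnMn -expnM.
  apply: (@leq_trans (Q ^ m * 64 ^ (n * K.+1 * m) * (D ^ E * C ^ (n * E)) * (a0 + 2))).
    rewrite leq_mul2r leq_mul2r; apply/orP; right; apply/orP; right.
    by rewrite (expnM 64) -(expnMn Q); move: (T) leT => T' leT; rewrite leq_exp2r.
  rewrite (_ : n * K.+1 * m = K.+1 * m * n); last by ring.
  rewrite (mulnC n E); move: (64 ^ _) (Q ^ m) (D ^ E) (C ^ _) => x1 x2 x3 x4.
  by apply: eq_leq; ring.
have H0 : 0 < (D * C ^ n) ^ E by rewrite expn_gt0 muln_gt0 D0 expn_gt0 C0.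
have Tm0 : 0 < T ^ m by rewrite expn_gt0 T0.
have leTm : T ^ m <= #|A|.
  by apply: leq_trans ltA; rewrite -mulnA leq_pmulr // muln_gt0 H0 addn2.
have a0A : a0 <= #|A|.
  apply: leq_trans ltA; apply: leq_trans (leq_addr 2 a0) _.
  by rewrite leq_pmull // muln_gt0 Tm0.
have HA : (D * C ^ n) ^ E < #|A|.
  apply: leq_trans ltA; rewrite -mulnA; apply: (@leq_trans ((D * C ^ n) ^ E * (a0 + 2))).
    by rewrite addnS ltn_Pmulr // addn1.
  by rewrite leq_pmull.
have A1 : 1 < #|A| by apply: leq_ltn_trans HA.
have A0 := ltnW A1.
have leTk k : k <= m -> T ^ k <= #|A| by move=> km; apply: leq_trans leTm; rewrite leq_pexp2l.
have lt4 : p * 4 ^ (n + n') < N by rewrite /N addn1.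
have leTA : T <= #|A| by rewrite -(expn1 T) leTk.
have [W [WA leW leS]] := exists_dense_tuples p_prime K0 ltN lt4 leTA noA.
rewrite -/T in leW leS.
have [W' [W'A cardW' sumW']] := tuples_to_tup (r := r) WA.
set S := #|[set _ | _ in W]| in leS *.
have sq : S ^ 2 * #|A| ^ 2 <= T ^ 2 * #|A| ^ d.+1.
  rewrite -expnMn mulnC; apply: (@leq_trans ((T * #|sumset K.+1 A|) ^ 2)); first by rewrite leq_exp2r.
  by rewrite expnMn leq_mul2l leG orbT.
have le_m k : k <= 8 -> k <= m by move=> k8; apply: leq_trans k8 _; rewrite leq_pmulr.
have [||A' [A'A A'sz A'l]] := BC _ A W' a0A W'A.
- rewrite expnM; apply: (@leq_trans ((T * #|W'|) ^ M)); first by rewrite leq_exp2r // cardW'.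
  by rewrite expnMn mulnC leq_mul2l leTk ?orbT // leq_pmull.
- rewrite sumW' -/S.
  have S2 : S ^ 2 <= #|A| ^ d.
    rewrite -(@leq_pmul2r (#|A| ^ 2)) ?expn_gt0 ?A0 //; apply: leq_trans sq _.
    by rewrite -expnD addn2 [X in _ <= X]expnS leq_mul2r leTk ?orbT // le_m.
  have -> : e = 2 * (4 * l) by rewrite /e mulnA.
  rewrite expnM; apply: (@leq_ltn_trans ((#|A| ^ d) ^ (4 * l))); first by rewrite leq_exp2r // muln_gt0.
  rewrite -expnM ltn_exp2l // /r /e addn1 ltnS leq_mul2l; apply/orP; right.
  by rewrite leq_mul2r orbT.
rewrite sumW' -/S in A'l.
have E2 : 2 <= E by rewrite /E (leq_trans _ (leq_pmulr 4 d0)).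
have leA' : D * C ^ n <= #|A'|.
  rewrite leqNgt; apply/negP => ltA'.
  have : #|A| ^ E < #|A| ^ 2.
    apply: leq_ltn_trans A'sz _; rewrite -mulnn ltn_pmul2r //; apply: leq_ltn_trans HA.
    by rewrite leq_exp2r // ltnW.
  by rewrite ltn_exp2l // ltnNge E2.
have A'0 : 0 < #|A'| by apply: leq_trans leA'; rewrite muln_gt0 D0 expn_gt0 C0.
(* Up to [T], [S] is at most [#|A| ^ ((d - 1) / 2)]. The losses 1/4 (Plunnecke), 1/8 ([T]) and 1/8
   ([A'] for [A]) add up to exactly the available 1/2. *)
have leA'G : #|sumset l A'| ^ 2 <= #|A'| ^ d.
  set U := #|sumset l A'| in A'l *.
  have U4 : U ^ 4 <= #|A| * S ^ 4.
    rewrite -(@leq_exp2r _ _ (2 * l)) ?muln_gt0 // expnMn -!expnM.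
    by have -> : 4 * (2 * l) = e by rewrite /e mulnA.
  have U8 : U ^ 8 <= #|A| ^ 2 * S ^ 8.
    by rewrite (expnM U 4 2) (expnM S 4 2) -expnMn leq_exp2r.
  have S8 : S ^ 8 * #|A| ^ 8 <= #|A| * #|A| ^ (4 * d.+1).
    apply: (@leq_trans (T ^ 8 * #|A| ^ (4 * d.+1))); last by rewrite leq_mul2r leTk ?orbT // le_m.
    rewrite [4 * d.+1]mulnC (expnM _ d.+1) (expnM S 2 4) (expnM #|A| 2 4) (expnM T 2 4).
    by rewrite -(expnMn (S ^ 2)) -(expnMn (T ^ 2)) leq_exp2r.
  rewrite -(@leq_exp2r _ _ 4) // -!expnM [d * 4]mulnC -(@leq_pmul2r (#|A| ^ 8)) ?expn_gt0 ?A0 //.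
  apply: (@leq_trans (#|A| ^ 2 * (#|A| * #|A| ^ (4 * d.+1)))).
    apply: leq_trans (leq_mul U8 (leqnn _)) _.
    by rewrite -mulnA leq_mul2l S8 orbT.
  apply: (@leq_trans (#|A| ^ 7 * #|A| ^ (4 * d))).
    by rewrite -expnS -!expnD leq_exp2l //; lia.
  apply: leq_trans (leq_mul (leqnn _) A'sz) _.
  by rewrite mulnCA leq_mul2l -expnSr leqnn orbT.
have [x [x_inj [xA' x0]]] := DP n A' leA' leA'G.
by exists x; split=> //; split=> // i; exact: (subsetP A'A).
Qed.

Lemma small_growth d : 0 < d -> small_growth_suffices d.
Proof.
case: d => // d _; elim: d => [|d IHd]; [exact: small_growth_base | exact: small_growth_step].
Qed.
Local Close Scope nat_scope.
Local Open Scope ring_scope.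
Unset Implicit Arguments.

Theorem theorem2p1 (R : realType) (c : R) (hc : 1 < c) :
  exists l : nat, (0 < l)%N /\
  exists C : R, 1 <= C /\
  exists p0 : nat, forall p : nat, prime p -> (p0 <= p)%N ->
  exists D : R, 1 <= D /\
  forall n : nat, (0 < n)%N ->
  forall A : {set 'rV['F_p]_n},
    D * C ^+ n <= #|A|%:R ->
    #|sumset l A|%:R <= #|A|%:R `^ c ->
    exists x : 'I_p -> 'rV['F_p]_n,
      injective x /\ (forall i : 'I_p, x i \in A) /\ \sum_(i < p) x i = 0.
Proof.
(* Squaring [|lA| <= |A| ^ c] gives the exponent [2 * c], which is rounded up to a natural
   number. *)
pose d := Num.bound (2 * c).
have cd : 2 * c < d%:R by apply: archi_boundP; lra.
have d0 : (0 < d)%N by rewrite -(ltr_nat R); lra.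
have [l [C [p0 [l0 C0 H]]]] := small_growth d0.
exists l; split=> //; exists C%:R; split; first by rewrite ler1n.
exists p0 => p p_prime p0p; have [D D0 DP] := H p p_prime p0p.
exists D%:R; split; first by rewrite ler1n.
move=> n _ A; rewrite -natrX -natrM ler_nat => leA leS.
apply: DP => //; rewrite -(ler_nat R) !natrX.
have A1 : (1 : R) <= #|A|%:R.
  rewrite ler1n; apply: leq_trans leA; rewrite muln_gt0 D0 expn_gt0 C0 //.
apply: (@le_trans _ _ ((#|A|%:R `^ c) ^+ 2)).
  by rewrite lerXn2r // nnegrE ?ler0n ?powR_ge0.
rewrite -!powR_mulrn ?powR_ge0 ?ler0n // -powRrM ler_powR //; lra.
Qed.
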